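(* Suppose that the reference path measure $R\in\mathrm{M}_+(\Omega)$ satisfies (i) $R_0=R_1=m\in\mathrm{M}_+(\mathcal{X})$; (ii) $R_{01}(dxdy)\ge e^{-A(x)-A(y)}\,m(dx)m(dy)$ for some nonnegative measurable function $A$ on $\mathcal{X}$; (iii) $\int_{\mathcal{X}^2}e^{-B(x)-B(y)}\,R_{01}(dxdy)<\infty$ for some nonnegative measurable function $B$ on $\mathcal{X}$; (iv) $m\otimes m\ll R_{01}$ or $R_{01}\ll m\otimes m$. Suppose also that the constraint $(\mu_0,\mu_1)$, with $\mu_0,\mu_1\in\mathrm{P}(\mathcal{X})$, satisfies (v) $H(\mu_0|m)<\infty$ and $H(\mu_1|m)<\infty$; (vi) $\int_{\mathcal{X}}(A+B)\,d\mu_0<\infty$ and $\int_{\mathcal{X}}(A+B)\,d\mu_1<\infty$, where $A$ and $B$ appear in (ii) and (iii); (vii) $(\mu_0,\mu_1)$ is internal. This is the case for instance when $m$ is a probability measure and $\mu_0,\mu_1\ge\epsilon m$ for some $\epsilon>0$. Then the dynamic Schrödinger problem $(\mathrm{S}_{\mathrm{dyn}})$ admits the unique solution $$\widehat P=f_0(X_0)g_1(X_1)\,R\in\mathrm{P}(\Omega),$$ where $f_0,g_1$ are positive $m$-measurable functions on $\mathcal{X}$ such that the unique solution $\widehat\pi$ of the static problem $(\mathrm{S})$ is $\widehat\pi(dxdy)=f_0(x)g_1(y)\,R_{01}(dxdy)$, and which solve the Schrödinger system $$\begin{cases} f_0(x)\,E_R[g_1(X_1)\mid X_0=x]=\dfrac{d\mu_0}{dm}(x),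 & \text{for } m\text{-a.e. }x,\\[2mm] g_1(y)\,E_R[f_0(X_0)\mid X_1=y]=\dfrac{d\mu_1}{dm}(y), & \text{for } m\text{-a.e. }y.\end{cases}$$
   Context: For a measurable space $Y$, $\mathrm{P}(Y)$ and $\mathrm{M}_+(Y)$ are the sets of probability measures and of positive measures on $Y$. $\mathcal{X}$ is a Polish space with its Borel $\sigma$-field; $\Omega$ is either $C([0,1],\mathcal{X})$ or the space $D([0,1],\mathcal{X})$ of càdlàg paths (Skorokhod topology), with the $\sigma$-field generated by the canonical process $X_t(\omega)=\omega_t$, $0\le t\le1$. For $Q\in\mathrm{M}_+(\Omega)$, $Q_t:=(X_t)_\#Q$ and $Q_{01}:=(X_0,X_1)_\#Q\in\mathrm{M}_+(\mathcal{X}^2)$. For $\pi\in\mathrm{P}(\mathcal{X}^2)$, $\pi_0,\pi_1$ are its first and second marginals. The reference path measure $R\in\mathrm{M}_+(\Omega)$ is a nonzero $\sigma$-finite measure, possibly of infinite mass. Conditional expectations of nonnegative functions under $R$ are understood with values in $[0,\infty]$ (no integrability required). Relative entropy: for a $\sigma$-finite positive measure $r$ and $p\in\mathrm{P}(Y)$, $H(p|r):=\int_Y\log(dp/dr)\,dp\in(-\infty,\infty]$ if $p\ll r$ and the integral is meaningful, and $H(p|r)=\infty$ otherwise. If $r$ is a probability measure the integral is always meaningful. In general it is meaningful when there is a measurable $W:Y\to[1,\infty)$ with $z_W:=\int_Y e^{-W}dr<\infty$ and $\int_Y W\,dp<\infty$; then $H(p|r)=H(p|r_W)-\int_Y W\,dp-\log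 z_W$ with $r_W:=z_W^{-1}e^{-W}r$. Schrödinger problems, for $\mu_0,\mu_1\in\mathrm{P}(\mathcal{X})$: $(\mathrm{S}_{\mathrm{dyn}})$: minimize $H(P|R)$ over $P\in\mathrm{P}(\Omega)$ with $P_0=\mu_0$, $P_1=\mu_1$. $(\mathrm{S})$: minimize $H(\pi|R_{01})$ over $\pi\in\mathrm{P}(\mathcal{X}^2)$ with $\pi_0=\mu_0$, $\pi_1=\mu_1$. A solution is a minimizer with finite value. Internal constraint: let $\mathcal{C}$ be the convex set of all $(\mu_0,\mu_1)\in\mathrm{P}(\mathcal{X})^2$ for which $\inf(\mathrm{S})<\infty$ (the set of admissible constraints). The pair $(\mu_0,\mu_1)$ is called internal if it belongs to the intrinsic core $\operatorname{icor}\mathcal{C}$, where for any convex set $C$, $\operatorname{icor}C:=\{y\in C:\ \exists x,z\in C:\ y\in\,]x,z[\,\}$ and $]x,z[:=\{(1-t)x+tz:0<t<1\}\subset C$.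
   Formalization: The functions f_0, g_1 are only asserted nonnegative, not strictly positive: f_0 must vanish where dμ_0/dm=0 (e.g. two points, R_01=m⊗m uniform, μ_0 a Dirac mass, μ_1=m). Where dμ_0/dm>0 (resp. dμ_1/dm>0) the Schrödinger system itself gives f_0>0 (resp. g_1>0) a.e. *)

(* Defs.v *)
From HB Require Import structures.
From mathcomp Require Import all_boot all_order all_algebra.
From mathcomp Require Import all_classical all_reals all_analysis.
From mathcomp Require Import measurable_realfun.

Set Implicit Arguments.
Unset Strict Implicit.
Unset Printing Implicit Defensive.

Import Order.TTheory GRing.Theory Num.Theory.
Import numFieldNormedType.Exports.

Local Open Scope classical_set_scope.
Local Open Scope ring_scope.
Local Open Scope ereal_scope.

Notation borel X := (g_sigma_algebraType (@open X)).

(** ** Paths *)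

(* set_type carries the topology induced by the inclusion. *)
Notation time R := (set_type `[0%R : R, 1%R : R]%classic).

Section paths.
Context {R : realType}.

Fact time0_subproof : (0%R : R) \in `[0%R, 1%R]%classic.
Proof. by rewrite inE/= in_itv/= lexx ler01. Qed.

Fact time1_subproof : (1%R : R) \in `[0%R, 1%R]%classic.
Proof. by rewrite inE/= in_itv/= lexx ler01. Qed.

Definition time0 : time R := exist _ 0%R time0_subproof.
Definition time1 : time R := exist _ 1%R time1_subproof.

(* At t = 1 (resp. t = 0) the right (resp. left) filter is degenerate, so the
   corresponding condition is void. *)
Definition cadlag (X : ptopologicalType) (w : time R -> X) : Prop :=
  forall t : time R,
    w s @[s --> within (fun s : time R => (val t < val s)%R) (nbhs t)] --> w t /\
    exists l : X,
      w s @[s --> within (fun s : time R => (val s < val t)%R) (nbhs t)] --> l.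

End paths.

Inductive path_kind := Continuous | Cadlag.

Section path_space.
Context {R : realType}.
Variables (X : ptopologicalType) (k : path_kind).

Definition path_set : set (time R -> X) :=
  match k with
  | Continuous => [set w | continuous w]
  | Cadlag => [set w | cadlag w]
  end.

Definition Omega : Type := path_set.

Fact cst_path_subproof : (fun=> point) \in path_set.
Proof.
rewrite inE /path_set; case: k => /=; first exact: cst_continuous.
move=> t; split; first exact: cvg_cst.
by exists point; exact: cvg_cst.
Qed.

HB.instance Definition _ := Choice.on Omega.
HB.instance Definition _ :=
  isPointed.Build Omega (exist _ (fun=> point) cst_path_subproof).

Definition coord (t : time R) (w : Omega) : borel X := val w t.

Definition cylinders : set (set Omega) :=
  [set E | exists t (B : set (borel X)), measurable B /\ E = coord t @^-1` B].

End path_space.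
Arguments Omega R X k : clear implicits.

Notation pathspace R X k := (g_sigma_algebraType (@cylinders R X k)).

Section canonical_process.
Context {R : realType} {X : ptopologicalType} {k : path_kind}.

Definition X0 : pathspace R X k -> borel X := coord time0.
Definition X1 : pathspace R X k -> borel X := coord time1.

Definition law0 (Q : set (pathspace R X k) -> \bar R) : set (borel X) -> \bar R :=
  pushforward Q X0.
Definition law1 (Q : set (pathspace R X k) -> \bar R) : set (borel X) -> \bar R :=
  pushforward Q X1.
Definition law01 (Q : set (pathspace R X k) -> \bar R) :
    set (borel X * borel X)%type -> \bar R :=
  pushforward Q (fun w => (X0 w, X1 w)).

End canonical_process.

(** ** Densities, conditional expectation and relative entropy *)

Section measures.
Context d (T : measurableType d) {R : realType}.
Implicit Types p q r : set T -> \bar R.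

(* Library measures are functions on all sets, whose values off the
   sigma-algebra are irrelevant. *)
Definition measure_eq p q := forall E, measurable E -> p E = q E.

Definition with_density (h : T -> R) r : set T -> \bar R :=
  fun E => \int[r]_(x in E) (h x)%:E.

Definition is_density p r (h : T -> R) :=
  [/\ measurable_fun setT h, (forall x, 0 <= h x)%R
    & measure_eq p (with_density h r)].

(* dp/dr. The library's 'd p '/d r needs r packaged as a sigma-finite measure,
   which an image measure such as law01 Q is not in general. *)
Definition rn_deriv p r : T -> R := xget (fun=> 0%R) (is_density p r).

(* The integral is meaningful, with value in ]-oo, +oo], when the negative part
   is integrable. *)
Definition entropy p r : \bar R :=
  let l := fun x => (ln (rn_deriv p r x))%:E in
  if `[< p `<< r /\ \int[p]_x l^\- x < +oo >] then \int[p]_x l x else +oo.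

End measures.

Section conditional_expectation.
Context d d' (T : measurableType d) (T' : measurableType d') {R : realType}.
Variables (Q : set T -> \bar R) (Y : T -> T') (U : T -> R).

Definition is_cond_exp (e : T' -> \bar R) :=
  [/\ measurable_fun setT e, (forall y, 0 <= e y)
    & forall E, measurable E ->
        \int[Q]_(w in Y @^-1` E) (U w)%:E = \int[pushforward Q Y]_(y in E) e y].

(* y |-> E_Q[U | Y = y], for nonnegative U; it may take the value +oo. *)
Definition cond_exp : T' -> \bar R := xget (fun=> 0) is_cond_exp.

End conditional_expectation.

(** ** Schrödinger problems *)

Section solutions.
Context d (T : measurableType d) {R : realType}.
Variables (r : set T -> \bar R) (S : set (probability T R)).

Definition solution : set (probability T R) :=
  [set p | [/\ S p, entropy p r \is a fin_num
             & forall q : probability T R, S q -> entropy p r <= entropy q r]].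

Definition unique_solution (p : probability T R) :=
  solution p /\ forall q : probability T R, solution q -> measure_eq q p.

End solutions.

Section schrodinger.
Context {R : realType} {X : ptopologicalType}.
Implicit Types mu : probability (borel X) R.

Definition couplings mu0 mu1 : set (probability (borel X * borel X)%type R) :=
  [set p | measure_eq (pushforward p fst) mu0 /\
           measure_eq (pushforward p snd) mu1].

Definition path_couplings k mu0 mu1 : set (probability (pathspace R X k) R) :=
  [set P | measure_eq (law0 P) mu0 /\ measure_eq (law1 P) mu1].

Definition static_inf (r : set (borel X * borel X)%type -> \bar R) mu0 mu1 :=
  ereal_inf [set entropy p r | p in couplings mu0 mu1].

Definition admissible (r : set (borel X * borel X)%type -> \bar R) :
    set (probability (borel X) R * probability (borel X) R) :=
  [set mu | static_inf r mu.1 mu.2 < +oo].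

Definition mixture (t : R) mu nu : set (borel X) -> \bar R :=
  fun E => (1 - t)%:E * mu E + t%:E * nu E.

(* x = z is not excluded: ]x, x[ = {x}. *)
Definition icor (C : set (probability (borel X) R * probability (borel X) R)) :
    set (probability (borel X) R * probability (borel X) R) :=
  [set y | C y /\ exists x z, [/\ C x, C z & exists t : R,
    [/\ (0 < t < 1)%R, measure_eq y.1 (mixture t x.1 z.1)
      & measure_eq y.2 (mixture t x.2 z.2)]]].

Definition internal (r : set (borel X * borel X)%type -> \bar R) mu0 mu1 :=
  icor (admissible r) (mu0, mu1).

End schrodinger.

(* Main.v *)
(** The static problem is solved through its dual.  After multiplying [R_01] by
    [exp (- B (+) B)] it becomes a finite measure [nu]; this shifts the entropy
    of every coupling by the same constant.  Consider
      D(phi, psi) = \int phi dmu0 + \int psi dmu1 - \int exp (phi (+) psi) dnu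
    for bounded [phi] and [psi].  Hypotheses (ii), (v), (vi) bound [D] from
    above, by comparison with [mu0 (x) mu1].  The parallelogram identity
      2 D(average) - D - D' = \int (exp (v / 2) - exp (v' / 2)) ^ 2 dnu,
    with [v = phi (+) psi] and [v' = phi' (+) psi'], makes [exp (v_n / 2)]
    Cauchy in [L^2(nu)] along a maximizing sequence, so that [exp v_n] converges
    to a density [k]; varying the potentials by multiples of indicators shows
    that [k nu] is a coupling of [mu0] and [mu1], and scaling them shows that
    its entropy is at most [sup D + 1], which is a lower bound for the entropy
    of all couplings.
    The bound by [mu0 (x) mu1] also forces [k > 0] almost everywhere for
    [mu0 (x) mu1]; hence [v_n] converges on almost every fibre, the potentials
    converge separately after normalization at one point, and [k] is a product
    [f (x) g].  As every coupling, of the endpoints or of path laws, gives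
    [v_n] the same integral, one argument proves optimality and uniqueness in
    both problems: the gap between the entropy of a competitor and the optimal
    value controls its squared Hellinger distance to the candidate. *)
Require Import Defs.
From HB Require Import structures.
From mathcomp Require Import all_boot all_order all_algebra.
From mathcomp Require Import all_classical all_reals all_analysis.
From mathcomp Require Import measurable_realfun ring lra.

Set Implicit Arguments.
Unset Strict Implicit.
Unset Printing Implicit Defensive.

Import Order.TTheory GRing.Theory Num.Theory.
Import numFieldNormedType.Exports.

Local Open Scope classical_set_scope.
Local Open Scope ring_scope.
Local Open Scope ereal_scope.

(** * Measures with densities *)

(** Packages an image as a bundled measure, so that results about measures apply to the bare set
    functions [law0], [law1] and [law01]. *)
Lemma image_measure d d' (T : measurableType d) (T' : measurableType d')
    (R : realType) (p : {measure set T -> \bar R}) (f : T -> T') :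
  measurable_fun setT f ->
  exists q : {measure set T' -> \bar R},
    pushforward p f = q :> (set T' -> \bar R).
Proof. by move=> mf; unshelve eexists; [exact: (pushforward p f)|]. Qed.

Section measure_with_density.
Context d (T : measurableType d) (R : realType).
Implicit Types p q : {measure set T -> \bar R}.
Import HBNNSimple.

Lemma measure_of_density (e : T -> \bar R) p :
  measurable_fun setT e -> (forall x, 0 <= e x) ->
  exists q, (fun E => \int[p]_(x in E) e x) = q :> (set T -> \bar R).
Proof.
move=> me e0; pose q E := \int[p]_(x in E) e x.
have q0 : q set0 = 0 by rewrite /q integral_set0.
have q_ge0 E : 0 <= q E by exact: integral_ge0.
have qsa : semi_sigma_additive q.
  move=> F mF tF mUF; rewrite /q ge0_integral_bigcup//; last first.
    exact: measurable_funTS.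
  by apply: is_cvg_nneseries => n _ _; exact: integral_ge0.
pose m := isMeasure.Build _ _ _ q q0 q_ge0 qsa.
by exists (HB.pack_for {measure set T -> \bar R} q m).
Qed.

(** Monotone convergence along simple functions increasing to [f]. The density [e] may be infinite,
    as a conditional expectation can be. *)
Lemma ge0_integral_density p q (e f : T -> \bar R) :
  measurable_fun setT e -> (forall x, 0 <= e x) ->
  (forall E, measurable E -> q E = \int[p]_(x in E) e x) ->
  measurable_fun setT f -> (forall x, 0 <= f x) ->
  \int[q]_x f x = \int[p]_x (f x * e x).
Proof.
move=> me e0 qE mf f0.
pose h := nnsfun_approx measurableT mf.
have hf x : (h n x)%:E @[n --> \oo] --> f x by exact: cvg_nnsfun_approx.
have nd_h x m n : (m <= n)%N -> (h m x <= h n x)%R.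
  by move=> mn; exact/lefP/nd_nnsfun_approx.
have hf_le n x : (h n x)%:E <= f x.
  rewrite -(cvg_lim _ (hf x))//; apply: lime_ge; first exact: cvgP (hf x).
  by exists n => // m nm; rewrite /= lee_fin nd_h.
(* Multiplication is discontinuous at the pair of 0 and [+oo]. If [f x = 0], every [h n x] is 0; if
   [e x = +oo] and [f x > 0], the products are eventually [+oo]. *)
have hef x : (h n x)%:E * e x @[n --> \oo] --> f x * e x.
  have [fx0|foo] := eqVneq (f x) 0.
    rewrite fx0 mul0e; apply: cvg_near_cst; apply: nearW => n.
    suff -> : (h n x)%:E = 0 by rewrite mul0e.
    by apply/eqP; rewrite eq_le -{1}fx0 hf_le lee_fin/=.
  have [eoo|efin] := eqVneq (e x) +oo; last first.
    by apply: cvgeZr => //; rewrite ge0_fin_numE// ltey.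
  have f_gt0 : 0 < f x by rewrite lt_neqAle eq_sym foo f0.
  rewrite eoo gt0_muley//; apply: cvg_near_cst.
  have : \forall n \near \oo, 0 < (h n x)%:E.
    exact: (hf x _ (open_ereal_gt' f_gt0)).
  by apply: filterS => n /gt0_muley.
transitivity (limn (fun n => \int[q]_x (h n x)%:E)).
  rewrite -monotone_convergence//.
  - by apply: eq_integral => x _; apply/esym/cvg_lim.
  - by move=> n; exact/measurable_EFinP.
  - by move=> n x _; rewrite lee_fin.
  - by move=> x _ m n mn; rewrite lee_fin nd_h.
transitivity (limn (fun n => \int[p]_x ((h n x)%:E * e x))); last first.
  rewrite -monotone_convergence//.
  - by apply: eq_integral => x _; apply/cvg_lim.
  - by move=> n; apply: emeasurable_funM => //; exact/measurable_EFinP.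
  - by move=> n x _; apply: mule_ge0 => //; rewrite lee_fin.
  - by move=> x _ m n mn; rewrite lee_wpmul2r// lee_fin nd_h.
congr (limn _); apply/funext => n.
under eq_integral do rewrite fimfunE -fsumEFin//.
rewrite ge0_integral_fsum//; last 2 first.
  - by move=> y; exact/measurable_EFinP/measurable_funM.
  - by move=> y x _; exact: nnfun_muleindic_ge0.
rewrite [RHS](eq_integral (fun x => \sum_(y \in range (h n))
    (y * \1_(h n @^-1` [set y]) x)%:E * e x)); last first.
  move=> x _; rewrite fimfunE -fsumEFin// ge0_mule_fsuml// => y.
  exact: nnfun_muleindic_ge0.
rewrite ge0_integral_fsum//; last 2 first.
  - move=> y; apply: emeasurable_funM => //.
    exact/measurable_EFinP/measurable_funM.
  - by move=> y x _; rewrite mule_ge0// nnfun_muleindic_ge0.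
apply: eq_fsbigr => r; rewrite inE => -[t _ tr].
have r0 : (0 <= r)%R by rewrite -tr.
have mA : measurable (h n @^-1` [set r]) by [].
transitivity (r%:E * q (h n @^-1` [set r])).
  under eq_integral do rewrite EFinM.
  rewrite ge0_integralZl//; last exact/measurable_EFinP.
  by rewrite integral_indic// setIT.
rewrite qE// integral_mkcond -ge0_integralZl//; last 2 first.
  - by apply/(measurable_restrictT e mA); exact: measurable_funTS.
  - by move=> x _; rewrite patchE; case: ifP.
apply: eq_integral => x _; rewrite epatch_indic EFinM -muleA; congr (_ * _).
by rewrite muleC.
Qed.

Lemma dominates_density p q (e : T -> \bar R) :
  measurable_fun setT e ->
  (forall E, measurable E -> q E = \int[p]_(x in E) e x) -> q `<< p.
Proof.
move=> me qE; apply/null_content_dominatesP => E mE pE0.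
by rewrite qE// null_set_integral//; exact: measurable_funTS.
Qed.

Lemma measure0_integral0 p (e : T -> \bar R) (E : set T) :
  measurable_fun setT e -> (forall x, 0 < e x) -> measurable E ->
  \int[p]_(x in E) e x = 0 -> p E = 0.
Proof.
move=> me e0 mE eE0.
have h1 : \int[p]_(x in E) `|e x| = 0.
  by rewrite -[RHS]eE0; apply: eq_integral => x _; rewrite gee0_abs// ltW.
have [N [mN N0 EN]] := (ae_eq_integral_abs _ mE (measurable_funTS me)).1 h1.
apply: (subset_measure0 mE mN _ N0) => x Ex; apply: EN => /= /(_ Ex) /eqP.
by rewrite gt_eqF.
Qed.

Lemma ae_dominates p q (P : set T) :
  q `<< p -> {ae p, forall x, P x} -> {ae q, forall x, P x}.
Proof.
by move=> /null_content_dominatesP qp [N [mN N0 PN]]; exists N; split => //; exact: qp.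
Qed.

Lemma integrable_density p q (h f : T -> R) :
  measurable_fun setT h -> (forall x, 0 <= h x)%R ->
  (forall E, measurable E -> q E = \int[p]_(x in E) (h x)%:E) ->
  measurable_fun setT f ->
  p.-integrable setT (fun x => (f x * h x)%:E) <->
  q.-integrable setT (EFin \o f).
Proof.
move=> mh h0 qE mf.
have mE : measurable_fun setT (EFin \o h) by exact/measurable_EFinP.
have mf' : measurable_fun setT (EFin \o f) by exact/measurable_EFinP.
have h0' x : 0 <= (h x)%:E by rewrite lee_fin.
have absE : \int[p]_x `|(f x * h x)%:E| = \int[q]_x `|(f x)%:E|.
  rewrite (ge0_integral_density mE h0' qE)//; last exact: measurableT_comp.
  by apply: eq_integral => x _; rewrite EFinM abseM [X in _ * X]gee0_abs.
split => /integrableP[m foo]; apply/integrableP; split => //.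
- by rewrite -absE.
- by apply/measurable_EFinP; exact: measurable_funM.
- by rewrite absE.
Qed.

Lemma integral_density p q (h f : T -> R) :
  measurable_fun setT h -> (forall x, 0 <= h x)%R ->
  (forall E, measurable E -> q E = \int[p]_(x in E) (h x)%:E) ->
  measurable_fun setT f ->
  \int[q]_x (f x)%:E = \int[p]_x (f x * h x)%:E.
Proof.
move=> mh h0 qE mf.
have mE : measurable_fun setT (EFin \o h) by exact/measurable_EFinP.
have mf' : measurable_fun setT (EFin \o f) by exact/measurable_EFinP.
have h0' x : 0 <= (h x)%:E by rewrite lee_fin.
have qint F := @ge0_integral_density p q (EFin \o h) F mE h0' qE.
rewrite [LHS]integralE [RHS]integralE; congr (_ - _).
- rewrite qint//; last exact: measurable_funepos.
  apply: eq_integral => x _.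
  by rewrite !funeposE EFinM maxe_pMl ?lee_fin// mul0e.
- rewrite qint//; last exact: measurable_funeneg.
  apply: eq_integral => x _.
  by rewrite !funenegE maxe_pMl ?lee_fin// mul0e mulNe EFinM.
Qed.

(** By Markov's inequality the level sets of [w] above [1 / n.+1] have finite measure; they exhaust
    the space because [w] is positive. *)
Lemma sigma_finite_integrable p (w : T -> R) :
  measurable_fun setT w -> (forall x, 0 < w x)%R ->
  \int[p]_x (w x)%:E < +oo -> sigma_finite setT p.
Proof.
move=> mw w0 woo.
pose F n := [set x | (n.+1%:R^-1 <= w x)%R].
have mF n : measurable (F n).
  by rewrite -[F n]setTI; apply: measurable_fun_le.
exists F.
  apply/esym; rewrite -subTset => x _.
  have [n nw] := ltr_add_invr (w0 x).
  exists n => //=; rewrite /F/=.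
  by have := nw; rewrite add0r => /ltW.
move=> n; split => //.
have : (n.+1%:R^-1)%:E * p (F n) < +oo.
  apply: le_lt_trans woo; rewrite -integral_cst//.
  apply: (@le_trans _ _ (\int[p]_(x in F n) (w x)%:E)).
    apply: ge0_le_integral => //.
      by move=> x _; rewrite lee_fin invr_ge0.
    exact/measurable_EFinP/measurable_funTS.
  apply: ge0_subset_integral => //; first exact/measurable_EFinP.
  by move=> x _; rewrite lee_fin ltW.
have := measure_ge0 p (F n); case: (p (F n)) => [s _ _|_|//]; first exact: ltry.
by rewrite gt0_muley// lte_fin invr_gt0.
Qed.

(** The Radon-Nikodym theorem makes the set from which [rn_deriv] chooses nonempty: its
    extended-real density is finite everywhere, so [fine] yields a real one. *)
Lemma rn_deriv_density (p : {finite_measure set T -> \bar R}) (r : {sigma_finite_measure set T -> \bar R}) :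
  p `<< r -> is_density p r (rn_deriv p r).
Proof.
move=> pr; have [f [f0 ffin intf pf]] := radon_nikodym_sigma_finite pr.
have fE x : f x = (fine (f x))%:E by rewrite fineK.
apply: xgetPex; exists (fine \o f); split.
- apply/measurable_EFinP; rewrite (_ : EFin \o _ = f); last exact/funext.
  exact: measurable_int intf.
- by move=> x; rewrite /= fine_ge0.
- move=> E mE; rewrite pf// /with_density; apply: eq_integral => x _.
  by rewrite [LHS]fE.
Qed.

End measure_with_density.

(** * Rapidly converging sequences *)

(** The increments are at most [sqrt c / 2 ^ n], so the telescoping series converges and [s n] stays
    within [2 * sqrt c] of [s 0]. The bound on the squares later supplies a dominating function. *)
Lemma fast_cvg (R : realType) (s : R^nat) (c : R) :
  (forall n, 4 ^+ n * (s n.+1 - s n) ^+ 2 <= c)%R ->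
  cvgn s /\ forall n, (s n ^+ 2 <= 2 * s 0%N ^+ 2 + 8 * c)%R.
Proof.
move=> sc.
have c0 : (0 <= c)%R by have := sc 0%N; rewrite expr0 mul1r; apply: le_trans; rewrite sqr_ge0.
have s_le n : (`|s n.+1 - s n| <= Num.sqrt c * 2^-1 ^+ n)%R.
  rewrite -(@ler_pXn2r _ 2)// ?nnegrE// ?mulr_ge0 ?sqrtr_ge0 ?exprn_ge0 ?invr_ge0//.
  rewrite exprMn sqr_sqrtr// -exprM mulnC exprM -ler_pdivrMr ?exprn_gt0//.
  rewrite -exprVn real_normK ?num_real//.
  have -> : ((2^-1 ^+ 2)^-1 = 4 :> R)%R by rewrite -exprVn invrK -natrX.
  by rewrite mulrC.
have s_le0 n : (`|s n - s 0%N| <= Num.sqrt c * (2 - 2 * 2^-1 ^+ n))%R.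
  elim: n => [|n ih]; first by rewrite subrr normr0 expr0 mulr1 subrr mulr0.
  rewrite (le_trans (ler_distD (s n) _ _))// (le_trans (lerD (s_le n) ih))//.
  by rewrite -mulrDr ler_wpM2l ?sqrtr_ge0// exprS; lra.
split.
  have : cvgn (series (telescope s)).
    apply: normed_cvg; apply: series_le_cvg.
    - by move=> n; exact: normr_ge0.
    - by move=> n; apply: (@geometric_ge0 _ (Num.sqrt c) 2^-1 n); rewrite ?sqrtr_ge0.
    - exact: s_le.
    - by apply: is_cvg_geometric_series; rewrite ger0_norm//; lra.
  rewrite telescopeK => cs.
  have -> : s = (fun n => (s n - s 0%N) + s 0%N)%R.
    by apply/funext => n; rewrite subrK.
  by apply: is_cvgD => //; exact: is_cvg_cst.
move=> n.
have h1 : ((s n - s 0%N) ^+ 2 <= 4 * c)%R.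
  rewrite -real_normK ?num_real//.
  have -> : (4 * c = (Num.sqrt c * 2) ^+ 2)%R by rewrite exprMn sqr_sqrtr//; ring.
  rewrite ler_pXn2r ?nnegrE ?mulr_ge0 ?sqrtr_ge0//.
  rewrite (le_trans (s_le0 n))// ler_wpM2l ?sqrtr_ge0//.
  by have : (0 <= 2^-1 ^+ n :> R)%R by []; lra.
(* This square is the slack in [s n ^+ 2 <= 2 * s 0 ^+ 2 + 2 * (s n - s 0) ^+ 2]. *)
have := sqr_ge0 (s n - 2 * s 0%N).
nra.
Qed.

(** Multiplying by the indicator of the complement of [N] gives convergence everywhere, hence a
    measurable limit. Its value 0 on [N] matters when the limit density is factorized. *)
Lemma measurable_limit_off d (T : measurableType d) (R : realType)
    (h : (T -> R)^nat) (N : set T) :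
  (forall n, measurable_fun setT (h n)) -> measurable N ->
  (forall x, ~ N x -> cvgn (h ^~ x)) ->
  exists f : T -> R, [/\ measurable_fun setT f,
    forall x, ~ N x -> h n x @[n --> \oo] --> f x & forall x, N x -> f x = 0%R].
Proof.
move=> mh mN hN; pose h' n x := (h n x * \1_(~` N) x)%R.
have h'1 x : ~ N x -> h' ^~ x = h ^~ x.
  by move=> Nx; apply/funext => n; rewrite /h' indicE mem_set// mulr1.
have h'0 x : N x -> h' ^~ x = cst 0%R.
  move=> Nx; apply/funext => n; rewrite /h' indicE (_ : x \in ~` N = false) ?mulr0//.
  by rewrite memNset//= notK.
exists (fun x => limn (h' ^~ x)); split.
- apply: (@measurable_fun_cvg _ _ _ setT h').
    move=> n; apply: measurable_funM => //.
    by apply: measurable_indic; exact: measurableC.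
  move=> x _; have [xN|xN] := pselect (N x); last by rewrite h'1//; exact: hN.
  by rewrite h'0// lim_cst//; exact: cvg_cst.
- by move=> x Nx; rewrite h'1//; exact: hN.
- by move=> x Nx; rewrite h'0// lim_cst.
Qed.

(** Weighted by [4 ^ n], the squared increments have integrals at most [c / 2 ^ n]. Their sum [g0]
    is thus integrable, hence finite almost everywhere, and [fast_cvg] applies at each such [x] with
    the constant [g0 x]. *)
Lemma rapid_L2_cvg d (T : measurableType d) (R : realType)
    (p : {measure set T -> \bar R}) (s : (T -> R)^nat) (c : R) :
  (forall n, measurable_fun setT (s n)) ->
  \int[p]_x (s 0%N x ^+ 2)%:E < +oo -> (0 <= c)%R ->
  (forall n, \int[p]_x ((s n.+1 x - s n x) ^+ 2)%:E <= (c * 8^-1 ^+ n)%:E) ->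
  exists (t : T -> R) (g : T -> \bar R),
    [/\ measurable_fun setT t, {ae p, forall x, s n x @[n --> \oo] --> t x},
        p.-integrable setT g &
        {ae p, forall x, forall n, (s n x ^+ 2)%:E <= g x}].
Proof.
move=> ms s0oo c0 sc.
pose a n x := (4 ^+ n * (s n.+1 x - s n x) ^+ 2)%R.
have a0 n x : (0 <= a n x)%R by rewrite mulr_ge0 ?sqr_ge0// exprn_ge0.
have ma n : measurable_fun setT (a n).
  by apply: measurable_funM => //; apply: measurable_funX; exact: measurable_funB.
pose g0 x := \sum_(n <oo) (a n x)%:E.
have g00 x : 0 <= g0 x by apply: nneseries_ge0 => n _ _; rewrite lee_fin.
have mg0 : measurable_fun setT g0.
  apply: ge0_emeasurable_sum => [n x _ _|n _]; first by rewrite lee_fin.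
  exact/measurable_EFinP.
have ig0 : p.-integrable setT g0.
  apply/integrableP; split => //.
  under eq_integral do rewrite gee0_abs//.
  rewrite integral_nneseries//; last 2 first.
    by move=> n; exact/measurable_EFinP.
    by move=> n x _; rewrite lee_fin.
  apply: (@le_lt_trans _ _ (2 * c)%:E); last exact: ltry.
  apply: (le_trans _ (epsilon_trick0 xpredT (_ : 0 <= 2 * c)%R)); last by rewrite mulr_ge0.
  apply: lee_nneseries => [n _ _|n _].
    by apply: integral_ge0 => x _; rewrite lee_fin.
  rewrite (_ : _ / _ = 4 ^+ n * (c * 8^-1 ^+ n))%R; last first.
    rewrite mulrCA -exprMn (_ : 4 * 8^-1 = 2^-1 :> R)%R; last by lra.
    rewrite natrX exprS exprVn; field.
    by rewrite expf_neq0.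
  rewrite EFinM; under eq_integral do rewrite EFinM.
  rewrite ge0_integralZl//.
  - by rewrite lee_wpmul2l// lee_fin exprn_ge0.
  - by apply/measurable_EFinP; apply: measurable_funX; exact: measurable_funB.
  - by move=> x _; rewrite lee_fin sqr_ge0.
have := integrable_ae measurableT ig0 => -[N [mN N0 Ng0]].
have key x : ~ N x -> cvgn (s ^~ x) /\
    forall n, ((s n x ^+ 2)%:E <= (2 * s 0%N x ^+ 2)%:E + 8%:E * g0 x)%E.
  move=> Nx; have g0fin : g0 x \is a fin_num.
    by apply: contrapT => h; apply: Nx; apply: Ng0 => /=; apply/not_implyP; split.
  have ha n : (a n x <= fine (g0 x))%R.
    rewrite -lee_fin fineK// /g0 (nneseriesD1 (n := n))//=; last first.
      by move=> k _; rewrite lee_fin.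
    by rewrite leeDl// nneseries_ge0// => k _ _; rewrite lee_fin.
  have [h1 h2] := @fast_cvg R (s ^~ x) (fine (g0 x)) ha.
  by split => // n; rewrite -(fineK g0fin) -EFinM -EFinD lee_fin h2.
have [t [mt st _]] := measurable_limit_off ms mN (fun x Nx => (key x Nx).1).
exists t, (fun x => (2 * s 0%N x ^+ 2)%:E + 8%:E * g0 x); split => //.
- exists N; split => // x /= h; apply: contrapT => xN; apply: h.
  exact: st.
- apply: integrableD => //; last exact: integrableZl.
  under eq_fun do rewrite EFinM; apply: integrableZl => //.
  apply/integrableP; split.
    by apply/measurable_EFinP; exact: measurable_funX.
  by under eq_integral do rewrite gee0_abs ?lee_fin ?sqr_ge0//.
- exists N; split => // x /= h; apply: contrapT => xN; apply: h.
  exact: (key _ xN).2.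
Qed.

(** * Bounded functions, marginals and product measures *)

Section bounded_measurable.
Context d (T : measurableType d) (R : realType).
Implicit Types f g : T -> R.

(** The class from which the dual potentials are taken: its members are integrable for every finite
    measure, and it is stable under the averages, scalings and perturbations by indicators made
    below. *)
Definition bounded_measurable f :=
  measurable_fun setT f /\ exists c, forall x, (`|f x| <= c)%R.

Lemma bounded_measurableD f g : bounded_measurable f -> bounded_measurable g ->
  bounded_measurable (f \+ g)%R.
Proof.
move=> [mf [a fa]] [mg [b gb]]; split; first exact: measurable_funD.
by exists (a + b)%R => x; rewrite (le_trans (ler_normD _ _))// lerD.
Qed.

Lemma bounded_measurableZ (c : R) f : bounded_measurable f ->
  bounded_measurable (fun x => c * f x)%R.
Proof.
move=> [mf [a fa]]; split; first exact: measurable_funM.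
by exists (`|c| * a)%R => x; rewrite normrM ler_wpM2l.
Qed.

Lemma bounded_measurableM f g : bounded_measurable f -> bounded_measurable g ->
  bounded_measurable (f \* g)%R.
Proof.
move=> [mf [a fa]] [mg [b gb]]; split; first exact: measurable_funM.
by exists (a * b)%R => x; rewrite normrM ler_pM.
Qed.

Lemma bounded_measurable_indic (E : set T) : measurable E ->
  bounded_measurable (\1_E : T -> R).
Proof.
move=> mE; split; first exact: measurable_indic.
by exists 1%R => x; rewrite indicE; case: (x \in E); rewrite ?normr1 ?normr0.
Qed.

Lemma bounded_measurable_expR f : bounded_measurable f ->
  bounded_measurable (expR \o f).
Proof.
move=> [mf [a fa]]; split; first exact: measurableT_comp.
exists (expR a) => x /=; rewrite ger0_norm ?expR_ge0// ler_expR.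
exact: le_trans (ler_norm _) (fa x).
Qed.

Lemma bounded_measurable_integrable (p : {finite_measure set T -> \bar R}) f :
  bounded_measurable f -> p.-integrable setT (EFin \o f).
Proof.
move=> [mf [a fa]]; apply: measurable_bounded_integrable => //.
  exact: fin_num_fun_lty (@fin_num_measure _ _ _ p).
exists `|a|%R; split; first exact: num_real.
by move=> y ay x _; apply: (le_trans (fa x)); rewrite (le_trans (ler_norm a))// ltW.
Qed.

End bounded_measurable.

Section marginals.
Context d d' (T : measurableType d) (T' : measurableType d') (R : realType).
Variables (q : {measure set T -> \bar R}) (p : {measure set T' -> \bar R}).
Variable (X : T -> T').
Hypotheses (mX : measurable_fun setT X) (qp : measure_eq (pushforward q X) p).

Lemma ge0_integral_marginal (f : T' -> \bar R) :
  measurable_fun setT f -> (forall x, 0 <= f x) ->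
  \int[q]_x f (X x) = \int[p]_x f x.
Proof.
move=> mf f0; have [r rE] := image_measure q mX.
transitivity (\int[r]_x f x); first by rewrite -rE ge0_integral_pushforward.
by apply: eq_measure_integral => E mE _; rewrite -rE qp.
Qed.

Lemma integral_marginal (f : T' -> R) : p.-integrable setT (EFin \o f) ->
  q.-integrable setT (EFin \o (f \o X)) /\
  \int[q]_x (f (X x))%:E = \int[p]_x (f x)%:E.
Proof.
move=> /integrableP[mf foo].
have iq : q.-integrable setT (EFin \o (f \o X)).
  apply/integrableP; split; first exact: (measurableT_comp mf).
  rewrite (ge0_integral_marginal (f := fun x => `|(f x)%:E|))//.
  exact: measurableT_comp.
split => //.
have [r rE] := image_measure q mX.
transitivity (\int[r]_x (f x)%:E); first by rewrite -rE (integral_pushforward mX).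
by apply: eq_measure_integral => E mE _; rewrite -rE qp.
Qed.

End marginals.

Section product_marginals.
Context d0 d1 (T0 : measurableType d0) (T1 : measurableType d1) (R : realType).
Variables (p0 : probability T0 R) (p1 : probability T1 R).

Lemma product_measure_fst : measure_eq (pushforward (p0 \x p1) fst) p0.
Proof.
move=> E mE; rewrite /pushforward (_ : fst @^-1` E = E `*` setT); last first.
  by apply/seteqP; split => [z|z []].
transitivity (p0 E * p1 setT); first exact: product_measure1E.
by rewrite probability_setT mule1.
Qed.

Lemma product_measure_snd : measure_eq (pushforward (p0 \x p1) snd) p1.
Proof.
move=> E mE; rewrite /pushforward (_ : snd @^-1` E = setT `*` E); last first.
  by apply/seteqP; split => [z|z []].
transitivity (p0 setT * p1 E); first exact: product_measure1E.
by rewrite probability_setT mul1e.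
Qed.

Lemma integral_product_cst1 : \int[p0 \x p1]_z 1 = 1.
Proof.
rewrite integral_cst// mul1e; transitivity (p0 setT * p1 setT).
  by rewrite -product_measure1E// setXTT.
by rewrite !probability_setT mule1.
Qed.

End product_marginals.

(** * The dual problem and its maximizing sequences *)

Section sum_marginals.
Context d d0 d1 (T : measurableType d) (T0 : measurableType d0)
  (T1 : measurableType d1) (R : realType).
Variables (q : {measure set T -> \bar R}) (p0 : {measure set T0 -> \bar R})
  (p1 : {measure set T1 -> \bar R}) (X0 : T -> T0) (X1 : T -> T1).
Hypotheses (mX0 : measurable_fun setT X0) (mX1 : measurable_fun setT X1).
Hypotheses (q0 : measure_eq (pushforward q X0) p0)
  (q1 : measure_eq (pushforward q X1) p1).

(** Only the marginals of [q] enter. The linear part of the dual therefore takes a single value on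
    all couplings, and on all path laws with the prescribed endpoint laws. *)
Lemma integral_sum_marginals (f : T0 -> R) (g : T1 -> R) :
  p0.-integrable setT (EFin \o f) -> p1.-integrable setT (EFin \o g) ->
  q.-integrable setT (fun x => (f (X0 x) + g (X1 x))%:E) /\
  \int[q]_x (f (X0 x) + g (X1 x))%:E =
    (\int[p0]_x f x + \int[p1]_y g y)%R%:E.
Proof.
move=> /[dup] if0 /(integral_marginal mX0 q0)[iqf qf].
move=> /[dup] ig1 /(integral_marginal mX1 q1)[iqg qg].
split; first by under eq_fun do rewrite EFinD; exact: integrableD.
under eq_integral do rewrite EFinD.
rewrite integralD// qf qg EFinD.
by rewrite /Rintegral !fineK//; exact: integrable_fin_num.
Qed.

End sum_marginals.

Section dual_problem.
Context d0 d1 (T0 : measurableType d0) (T1 : measurableType d1) (R : realType).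
Variables (nu : {finite_measure set (T0 * T1)%type -> \bar R}).
Variables (mu0 : probability T0 R) (mu1 : probability T1 R).
Implicit Types (phi : T0 -> R) (psi : T1 -> R).

Definition dual_value phi psi : R :=
  (\int[mu0]_x phi x + \int[mu1]_y psi y
   - \int[nu]_z expR (phi z.1 + psi z.2))%R.

Lemma bounded_measurable_pair phi psi :
  bounded_measurable phi -> bounded_measurable psi ->
  bounded_measurable (fun z : (T0 * T1)%type => phi z.1 + psi z.2)%R.
Proof.
move=> [mphi [a pa]] [mpsi [b pb]]; split.
  by apply: measurable_funD; apply: measurableT_comp.
by exists (a + b)%R => z; rewrite (le_trans (ler_normD _ _))// lerD.
Qed.

Lemma integrable_exp_pair phi psi :
  bounded_measurable phi -> bounded_measurable psi ->
  nu.-integrable setT (fun z => (expR (phi z.1 + psi z.2))%:E).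
Proof.
move=> bphi bpsi; apply: bounded_measurable_integrable.
exact/bounded_measurable_expR/bounded_measurable_pair.
Qed.

(** The linear parts cancel. The exponentials combine as a square of a difference, whose cross term
    is the exponential of the averaged potentials. *)
Lemma dual_parallelogram phi psi phi' psi' :
  bounded_measurable phi -> bounded_measurable psi ->
  bounded_measurable phi' -> bounded_measurable psi' ->
  \int[nu]_z ((expR (2^-1 * (phi' z.1 + psi' z.2)) -
     expR (2^-1 * (phi z.1 + psi z.2))) ^+ 2)%:E =
  (2 * dual_value (fun x => 2^-1 * (phi x + phi' x))%R
     (fun y => 2^-1 * (psi y + psi' y))%R - dual_value phi psi - dual_value phi' psi')%:E.
Proof.
move=> b0 b1 b0' b1'.
have b0s := bounded_measurableZ 2^-1 (bounded_measurableD b0 b0').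
have b1s := bounded_measurableZ 2^-1 (bounded_measurableD b1 b1').
rewrite /dual_value !RintegralZl//; try exact: bounded_measurable_integrable (bounded_measurableD _ _).
rewrite !RintegralD//; try exact: bounded_measurable_integrable.
have i1 := integrable_exp_pair b0 b1.
have i2 := integrable_exp_pair b0' b1'.
have i3 := integrable_exp_pair b0s b1s.
transitivity (\int[nu]_z (expR (phi z.1 + psi z.2) + expR (phi' z.1 + psi' z.2)
   - 2 * expR (2^-1 * (phi z.1 + phi' z.1) + 2^-1 * (psi z.2 + psi' z.2)))%R%:E).
  apply: eq_integral => z _; congr EFin.
  have -> : expR (phi z.1 + psi z.2) = (expR (2^-1 * (phi z.1 + psi z.2)) ^+ 2)%R.
    by rewrite -expRM_natl; congr expR; field.
  have -> : expR (phi' z.1 + psi' z.2) = (expR (2^-1 * (phi' z.1 + psi' z.2)) ^+ 2)%R.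
    by rewrite -expRM_natl; congr expR; field.
  have -> : (2^-1 * (phi z.1 + phi' z.1) + 2^-1 * (psi z.2 + psi' z.2) =
    2^-1 * (phi z.1 + psi z.2) + 2^-1 * (phi' z.1 + psi' z.2))%R by ring.
  rewrite expRD; ring.
have i12 := integrableD measurableT i1 i2.
have i4 := integrableZl measurableT 2 i3.
rewrite -[LHS]fineK; last first.
  apply: integrable_fin_num => //.
  by under eq_fun do rewrite EFinB EFinD EFinM; exact: integrableB.
congr EFin; rewrite -/(Rintegral _ _ _) RintegralB// RintegralD// RintegralZl//.
by field.
Qed.
End dual_problem.

Section dual_bounds.
Context d0 d1 (T0 : measurableType d0) (T1 : measurableType d1) (R : realType).
Variables (nu : {finite_measure set (T0 * T1)%type -> \bar R}).
Variables (mu0 : probability T0 R) (mu1 : probability T1 R).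
Variables (G0 : T0 -> R) (G1 : T1 -> R).
Hypotheses (iG0 : mu0.-integrable setT (EFin \o G0))
  (iG1 : mu1.-integrable setT (EFin \o G1)).
(** The lower bound on [nu] is stated against test functions, the form in which it is both obtained
    and used. In the application, [G0] and [G1] are [A + B] plus the logarithms of the densities of
    [mu0] and [mu1]. *)
Hypothesis nu_ge : forall F : (T0 * T1)%type -> \bar R,
  measurable_fun setT F -> (forall z, 0 <= F z) ->
  \int[mu0 \x mu1]_z (F z * (expR (- (G0 z.1 + G1 z.2)))%:E) <= \int[nu]_z F z.
Implicit Types (phi : T0 -> R) (psi : T1 -> R).

Local Notation J phi psi := (\int[mu0]_x phi x + \int[mu1]_y psi y)%R.
Local Notation dual := (dual_value nu mu0 mu1).

Lemma integral_sum_product phi psi :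
  mu0.-integrable setT (EFin \o phi) -> mu1.-integrable setT (EFin \o psi) ->
  (mu0 \x mu1).-integrable setT (fun z => (phi z.1 + psi z.2)%:E) /\
  \int[mu0 \x mu1]_z (phi z.1 + psi z.2)%:E = (J phi psi)%:E.
Proof.
apply: (integral_sum_marginals (q := mu0 \x mu1) (X0 := fst) (X1 := snd)) => //.
- exact: product_measure_fst.
- exact: product_measure_snd.
Qed.

(* The integrand is nonnegative since [1 + w <= expR w]. *)
Lemma integral_dual_gap phi psi :
  bounded_measurable phi -> bounded_measurable psi ->
  \int[mu0 \x mu1]_z (expR (phi z.1 + psi z.2 - (G0 z.1 + G1 z.2)) -
     (1 + (phi z.1 + psi z.2 - (G0 z.1 + G1 z.2))))%:E
  <= (J G0 G1 - 1 - dual phi psi)%:E.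
Proof.
move=> b0 b1.
have [iv vE] := integral_sum_product (bounded_measurable_integrable mu0 b0)
  (bounded_measurable_integrable mu1 b1).
have [iG GE] := integral_sum_product iG0 iG1.
have ie := integrable_exp_pair nu b0 b1.
have mv := measurable_int _ iv; have mG := measurable_int _ iG.
have mvG : measurable_fun setT (fun z : (T0 * T1)%type => (phi z.1 + psi z.2 - (G0 z.1 + G1 z.2))%R).
  by apply: measurable_funB; exact/measurable_EFinP.
have eE : \int[mu0 \x mu1]_z (expR (phi z.1 + psi z.2 - (G0 z.1 + G1 z.2)))%:E
   <= (\int[nu]_z expR (phi z.1 + psi z.2))%R%:E.
  rewrite /Rintegral fineK; last exact: integrable_fin_num.
  under [leLHS]eq_integral do rewrite expRD EFinM.
  apply: (nu_ge (F := fun z => (expR (phi z.1 + psi z.2))%:E)).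
    exact: measurable_int ie.
  by move=> z; rewrite lee_fin expR_ge0.
have iev : (mu0 \x mu1).-integrable setT
    (fun z => (expR (phi z.1 + psi z.2 - (G0 z.1 + G1 z.2)))%:E).
  apply/integrableP; split; first exact/measurable_EFinP/measurableT_comp.
  under eq_integral do rewrite gee0_abs ?lee_fin ?expR_ge0//.
  exact: le_lt_trans eE (ltry _).
have i1 : (mu0 \x mu1).-integrable setT (cst 1).
  apply/integrableP; split => //=.
  by under eq_integral do rewrite normr1; rewrite integral_product_cst1 ltry.
have ivG := integrableB measurableT iv iG.
have ib := integrableD measurableT i1 ivG.
under eq_integral do rewrite EFinB EFinD EFinB.
rewrite integralB// integralD//; last first.
rewrite integralB// vE GE integral_product_cst1.
rewrite (le_trans (leeB eE (lexx _)))// -[X in _ - (_ + X)]EFinB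
  -[X in _ - X]EFinD -EFinB lee_fin /dual_value.
by lra.
Qed.

Lemma dual_le phi psi : bounded_measurable phi -> bounded_measurable psi ->
  (dual phi psi <= J G0 G1 - 1)%R.
Proof.
move=> b0 b1; rewrite -subr_ge0 -lee_fin.
apply: le_trans (integral_dual_gap b0 b1); apply: integral_ge0 => z _.
by rewrite lee_fin subr_ge0 expR_ge1Dx.
Qed.

(** The rate [8^-n] is dictated by [rapid_L2_cvg], since the parallelogram identity turns defects of
    the dual value into squared increments. *)
Lemma dual_maximizing_sequence : exists (D : R) (phi : (T0 -> R)^nat) (psi : (T1 -> R)^nat),
  [/\ forall n, bounded_measurable (phi n), forall n, bounded_measurable (psi n),
    forall n, (D - 8^-1 ^+ n <= dual (phi n) (psi n))%R &
    forall f g, bounded_measurable f -> bounded_measurable g -> (dual f g <= D)%R].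
Proof.
pose A := [set a | exists2 fg, bounded_measurable fg.1 /\ bounded_measurable fg.2
   & a = dual fg.1 fg.2].
have bm0 d (T : measurableType d) : bounded_measurable (cst 0%R : T -> R).
  by split => //; exists 0%R => x; rewrite normr0.
have supA : has_sup A.
  split; first by exists (dual (cst 0%R) (cst 0%R)), (cst 0%R, cst 0%R).
  by exists (J G0 G1 - 1)%R => _ [fg [? ?] ->]; exact: dual_le.
have /choice[fg fgP] (n : nat) : exists fg : (T0 -> R) * (T1 -> R),
  [/\ bounded_measurable fg.1, bounded_measurable fg.2 &
    (sup A - 8^-1 ^+ n <= dual fg.1 fg.2)%R].
  have n0 : (0 < 8^-1 ^+ n :> R)%R by [].
  have [_ [fg [? ?] ->] /ltW ?] := sup_adherent n0 supA.
  by exists fg.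
exists (sup A), (fun n => (fg n).1), (fun n => (fg n).2); split.
- by move=> n; have [] := fgP n.
- by move=> n; have [] := fgP n.
- by move=> n; have [] := fgP n.
- move=> f g bf bg; apply: ub_le_sup; first by case: supA.
  by exists (f, g).
Qed.

End dual_bounds.

(** * Fatou's lemma, dominated convergence and a slope criterion *)

Section fatou_bounds.
Context d (T : measurableType d) (R : realType) (p : {measure set T -> \bar R}).

Lemma limn_einf_ge0 (u : (\bar R)^nat) : (forall n, 0 <= u n) -> 0 <= limn_einf u.
Proof.
move=> u0; rewrite limn_einf_lim; apply: lime_ge; first exact: is_cvg_einfs.
by apply: nearW => n; apply: le_ereal_inf_tmp => _ [m _ <-].
Qed.

Lemma fatou_le (F : (T -> \bar R)^nat) (b : R^nat) (B : R) :
  (forall n, measurable_fun setT (F n)) -> (forall n x, 0 <= F n x) ->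
  (forall n, \int[p]_x F n x <= (b n)%:E) -> b n @[n --> \oo] --> B ->
  \int[p]_x limn_einf (F ^~ x) <= B%:E.
Proof.
move=> mF F0 Fb bB; apply: le_trans (fatou p measurableT mF _) _ => //.
rewrite limn_einf_lim; apply: lime_le; first exact: is_cvg_einfs.
apply: nearW => n.
have bB' : (b n)%:E @[n --> \oo] --> B%:E by apply: cvg_EFin => //; exact: nearW.
rewrite -(cvg_lim _ bB')//; apply: lime_ge; first exact: cvgP bB'.
exists n => // m /= nm; apply: le_trans (Fb m); apply: ereal_inf_lbound.
by exists m.
Qed.

Lemma measurable_fun_limn_einf (F : (T -> \bar R)^nat) :
  (forall n, measurable_fun setT (F n)) ->
  measurable_fun setT (fun x => limn_einf (F ^~ x)).
Proof.
move=> mF; rewrite /limn_einf; apply: measurableT_comp => //.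
apply: (measurable_fun_limn_esup (f := fun n x => - F n x)) => n.
exact: measurableT_comp.
Qed.

Lemma fatou_ae_le (F : (T -> \bar R)^nat) (f : T -> \bar R) (b : R^nat) (B : R) :
  (forall n, measurable_fun setT (F n)) -> (forall n x, 0 <= F n x) ->
  measurable_fun setT f -> (forall x, 0 <= f x) ->
  {ae p, forall x, f x <= limn_einf (F ^~ x)} ->
  (forall n, \int[p]_x F n x <= (b n)%:E) -> b n @[n --> \oo] --> B ->
  \int[p]_x f x <= B%:E.
Proof.
move=> mF F0 mf f0 fF Fb bB; apply: le_trans (fatou_le mF F0 Fb bB).
apply: ae_ge0_le_integral => //.
- by move=> x _; exact: limn_einf_ge0.
- exact: measurable_fun_limn_einf.
- by apply: filterS fF.
Qed.

End fatou_bounds.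

Section dominated_real.
Context d (T : measurableType d) (R : realType) (p : {measure set T -> \bar R}).

Lemma dominated_Rintegral (f : (T -> R)^nat) (h : T -> R) (g : T -> \bar R) :
  (forall n, measurable_fun setT (f n)) -> measurable_fun setT h ->
  {ae p, forall x, f n x @[n --> \oo] --> h x} ->
  p.-integrable setT g -> {ae p, forall x, forall n, `|f n x|%:E <= g x} ->
  [/\ forall n, p.-integrable setT (EFin \o f n), p.-integrable setT (EFin \o h) &
    (\int[p]_x f n x)%R @[n --> \oo] --> (\int[p]_x h x)%R].
Proof.
move=> mf mh fh ig fg.
have fh' : {ae p, forall x, setT x -> (EFin \o f n) x @[n --> \oo] --> (EFin \o h) x}.
  by apply: filterS fh => x fhx _; apply: cvg_EFin => //; exact: nearW.
have fg' : {ae p, forall x n, setT x -> `|(EFin \o f n) x| <= g x}.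
  by apply: filterS fg => x fgx n _; exact: fgx.
have mEf n : measurable_fun setT (EFin \o f n) by exact/measurable_EFinP.
have mEh : measurable_fun setT (EFin \o h) by exact/measurable_EFinP.
have [ih _ cvg_fh] := dominated_convergence measurableT mEf mEh fh' ig fg'.
split => //; last first.
  have := cvg_fh; rewrite -[in X in _ --> X](fineK (integrable_fin_num measurableT ih)).
  by move=> /fine_cvgP[_].
move=> n; have [mg goo] := integrableP _ _ _ ig.
apply/integrableP; split => //; apply: le_lt_trans goo.
apply: ae_ge0_le_integral => //; [exact: measurableT_comp|exact: measurableT_comp|].
by apply: filterS fg' => x /(_ n) h' _; rewrite (le_trans (h' I))// lee_abs.
Qed.

End dominated_real.

(* The two sides agree at [t = 0], hence have the same slope there. *)
Lemma exp_slope_eq (R : realType) (a b : R) : (0 <= b)%R ->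
  (forall t, t * a <= (expR t - 1) * b)%R -> a = b.
Proof.
move=> b0 h.
(* Multiplying by [1 - t] removes the exponential, because [(1 - t) * (expR t - 1) <= t]. *)
have h1 t : (t < 1 -> t * a * (1 - t) <= t * b)%R.
  move=> t1; have := expR_ge1Dx (- t); rewrite expRN => e1.
  have e0 := expR_gt0 t.
  have e2 : ((1 - t) * expR t <= 1)%R.
    have : ((1 - t) * expR t <= (expR t)^-1 * expR t)%R by rewrite ler_wpM2r// ltW.
    by rewrite mulVf// gt_eqF.
  have := h t; have t0 : (0 < 1 - t)%R by lra.
  by move=> ht; nra.
apply/eqP; rewrite eq_le; apply/andP; split; rewrite leNgt; apply/negP => ab.
- have a0 : (0 < a)%R by lra.
  (* With this [t], the product [t * a] is only half of [a - b], whereas [h1] requires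
     [a - b <= t * a]. The other case is symmetric. *)
  pose t := ((a - b) / (2 * a))%R.
  have ta : (2 * (t * a) = a - b)%R by rewrite /t; field; lra.
  have t0 : (0 < t)%R by rewrite divr_gt0; lra.
  have t1 : (t < 1)%R by rewrite ltr_pdivrMr; lra.
  by have := h1 t t1; nra.
- have [a0|a0] := lerP a 0.
    by have := h1 (- 1)%R; lra.
  pose t := (- (b - a) / (2 * a))%R.
  have ta : (2 * (t * a) = - (b - a))%R by rewrite /t; field; lra.
  have t0 : (t < 0)%R by nra.
  have t1 : (t < 1)%R by lra.
  by have := h1 t t1; nra.
Qed.

(** * The limit of a maximizing sequence and its marginals *)

Section maximizing_sequence.
Context d0 d1 (T0 : measurableType d0) (T1 : measurableType d1) (R : realType).
Variables (nu : {finite_measure set (T0 * T1)%type -> \bar R}).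
Variables (mu0 : probability T0 R) (mu1 : probability T1 R).
Variables (D : R) (phi : (T0 -> R)^nat) (psi : (T1 -> R)^nat).
Hypotheses (bphi : forall n, bounded_measurable (phi n))
  (bpsi : forall n, bounded_measurable (psi n)).
Hypothesis near_max : forall n, (D - 8^-1 ^+ n <= dual_value nu mu0 mu1 (phi n) (psi n))%R.
Hypothesis dual_le_D : forall f g, bounded_measurable f -> bounded_measurable g ->
  (dual_value nu mu0 mu1 f g <= D)%R.

Local Notation dual := (dual_value nu mu0 mu1).
Local Notation v n z := (phi n z.1 + psi n z.2)%R.
Local Notation J n := (\int[mu0]_x phi n x + \int[mu1]_y psi n y)%R.

Let bv n : bounded_measurable (fun z : (T0 * T1)%type => v n z).
Proof. exact: bounded_measurable_pair. Qed.

Let mv n : measurable_fun setT (fun z : (T0 * T1)%type => v n z).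
Proof. by have [] := bv n. Qed.

Let mexpv n : measurable_fun setT (fun z : (T0 * T1)%type => expR (v n z)).
Proof. exact: measurableT_comp. Qed.

Lemma exp_maximizing_cvg : exists (k : (T0 * T1)%type -> R) (g : (T0 * T1)%type -> \bar R),
  [/\ measurable_fun setT k, forall z, (0 <= k z)%R,
    {ae nu, forall z, expR (v n z) @[n --> \oo] --> k z},
    nu.-integrable setT g & {ae nu, forall z, forall n, (expR (v n z))%:E <= g z}].
Proof.
pose s n (z : (T0 * T1)%type) := expR (2^-1 * v n z).
have sE n z : (s n z ^+ 2 = expR (v n z))%R.
  by rewrite -expRM_natl; congr expR; field.
(* The constant is 2 because two consecutive defects add up to [8^-n + 8^-(n+1)], which is below
   [2 * 8^-n]. *)
have := @rapid_L2_cvg _ _ R nu s 2.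
case.
- by move=> n; apply: measurableT_comp => //; exact: measurable_funM.
- under eq_integral do rewrite sE.
  by rewrite ltey_eq integrable_fin_num//; exact: integrable_exp_pair.
- by [].
- move=> n; rewrite (dual_parallelogram nu mu0 mu1)// lee_fin.
  have h1 := near_max n; have h2 := near_max n.+1.
  have h3 := dual_le_D (bounded_measurableZ 2^-1 (bounded_measurableD (bphi n) (bphi n.+1)))
    (bounded_measurableZ 2^-1 (bounded_measurableD (bpsi n) (bpsi n.+1))).
  have h4 : (0 <= 8^-1 ^+ n :> R)%R by [].
  by rewrite exprS in h2; lra.
move=> t [g [mt st ig sg]]; exists (fun z => t z ^+ 2)%R, g; split => //.
- exact: measurable_funX.
- by move=> z; exact: sqr_ge0.
- apply: filterS st => z sz.
  under eq_fun do rewrite -sE expr2.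
  by rewrite expr2; exact: cvgM.
- by apply: filterS sg => z + n => /(_ n); rewrite sE.
Qed.

Variables (k : (T0 * T1)%type -> R) (g : (T0 * T1)%type -> \bar R).
Hypotheses (mk : measurable_fun setT k) (k0 : forall z, (0 <= k z)%R).
Hypothesis vk : {ae nu, forall z, expR (v n z) @[n --> \oo] --> k z}.
Hypotheses (ig : nu.-integrable setT g)
  (vg : {ae nu, forall z, forall n, (expR (v n z))%:E <= g z}).

Lemma cvg_integral_exp (E : set (T0 * T1)) : measurable E ->
  nu.-integrable setT (fun z => (\1_E z * k z)%:E) /\
  (\int[nu]_z (\1_E z * expR (v n z)))%R @[n --> \oo] --> (\int[nu]_z (\1_E z * k z))%R.
Proof.
move=> mE.
have [|||||_ ik cvgk] := @dominated_Rintegral _ _ R nu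
    (fun n z => \1_E z * expR (v n z))%R (fun z => \1_E z * k z)%R g.
- by move=> n; apply: measurable_funM => //; exact: measurable_indic.
- by apply: measurable_funM => //; exact: measurable_indic.
- by apply: filterS vk => z vkz; apply: cvgM => //; exact: cvg_cst.
- exact: ig.
- apply: filterS vg => z + n => /(_ n); apply: le_trans.
  rewrite lee_fin normrM (ger0_norm (expR_ge0 _)) ler_piMl ?expR_ge0//.
  by rewrite indicE; case: (z \in E); rewrite ?normr1 ?normr0.
by split.
Qed.

(** The hypothesis says that raising [v n] by [t] on [E], with linear gain [t * a], never beats [D].
    As the dual values tend to [D], the limit leaves [t * a <= (expR t - 1) * b] for every [t], with
    [b] the mass of [k] on [E], and [exp_slope_eq] concludes. *)
Lemma limit_mass_eq (E : set (T0 * T1)) (a : R) : measurable E ->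
  (forall t n, dual (phi n) (psi n) + t * a -
     (expR t - 1) * (\int[nu]_z (\1_E z * expR (v n z)))%R <= D)%R ->
  \int[nu]_(z in E) (k z)%:E = a%:E.
Proof.
move=> mE aE; have [ik cvgk] := cvg_integral_exp mE.
rewrite integral_mkcond (eq_integral (fun z => (\1_E z * k z)%:E)); last first.
  by move=> z _; rewrite epatch_indic EFinM muleC.
rewrite -[LHS]fineK; last exact: integrable_fin_num.
congr EFin; rewrite -/(Rintegral _ _ _); set b := Rintegral _ _ _.
have b0 : (0 <= b)%R.
  by apply: Rintegral_ge0 => z _; rewrite mulr_ge0// indicE.
have ht t : (t * a <= (expR t - 1) * b)%R.
  rewrite -subr_le0.
  apply: (@ler_cvg_to nat \oo _ _ (fun n => t * a - (expR t - 1) *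
    (\int[nu]_z (\1_E z * expR (v n z)))%R)%R (fun n => 8^-1 ^+ n)%R).
  - apply: cvgB; first exact: cvg_cst.
    by apply: cvgM => //; exact: cvg_cst.
  - by apply: cvg_expr; rewrite ger0_norm//; lra.
  - by apply: nearW => n; have := aE t n; have := near_max n; lra.
by apply/esym; exact: exp_slope_eq b0 ht.
Qed.

Lemma integral_indicM (E : set (T0 * T1)) n (t : R) : measurable E ->
  (\int[nu]_z (expR (v n z) + (expR t - 1) * (\1_E z * expR (v n z))))%R =
  (\int[nu]_z expR (v n z) + (expR t - 1) * \int[nu]_z (\1_E z * expR (v n z)))%R.
Proof.
move=> mE; have iv := integrable_exp_pair nu (bphi n) (bpsi n).
have i1 : nu.-integrable setT (fun z => (\1_E z * expR (v n z))%:E).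
  apply: (le_integrable measurableT _ _ iv).
    by apply/measurable_EFinP/measurable_funM => //; exact: measurable_indic.
  move=> z _ /=; rewrite lee_fin normrM ler_piMl ?normr_ge0//.
  by rewrite indicE; case: (z \in E); rewrite ?normr1 ?normr0.
rewrite RintegralD//; last exact: (integrableZl measurableT (expR t - 1)%R i1).
by rewrite RintegralZl.
Qed.

(** First-order condition in the direction of the indicator of [E], added to the first potential;
    the linear gain is [t * mu0 E]. *)
Lemma limit_marginal_fst (E : set T0) : measurable E ->
  \int[nu]_(z in fst @^-1` E) (k z)%:E = mu0 E.
Proof.
move=> mE; have mE' : measurable (fst @^-1` E : set (T0 * T1)).
  by rewrite -[X in measurable X]setTI; exact: measurable_fst.
rewrite -[RHS]fineK ?fin_num_measure//; apply: limit_mass_eq => // t n.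
have bt := bounded_measurableZ t (bounded_measurable_indic R mE).
apply: le_trans (dual_le_D (bounded_measurableD (bphi n) bt) (bpsi n)).
rewrite le_eqVlt; apply/orP; left; apply/eqP; rewrite /dual_value.
rewrite [in RHS]RintegralD//; try exact: bounded_measurable_integrable.
rewrite RintegralZl//; last exact: bounded_measurable_integrable (bounded_measurable_indic R mE).
rewrite (_ : \int[mu0]_x \1_E x = fine (mu0 E))%R; last first.
  by rewrite /Rintegral integral_indic// setIT.
rewrite [in RHS](_ : Rintegral nu _ _ = \int[nu]_z (expR (v n z) +
    (expR t - 1) * (\1_(fst @^-1` E) z * expR (v n z))))%R; last first.
  apply: eq_Rintegral => z _ /=; rewrite addrAC [LHS]expRD !indicE.
  rewrite (_ : (z \in fst @^-1` E) = (z.1 \in E))//.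
  by case: (z.1 \in E) => /=; rewrite ?mulr1 ?mulr0 ?expR0; ring.
by rewrite integral_indicM//; ring.
Qed.

Lemma limit_marginal_snd (E : set T1) : measurable E ->
  \int[nu]_(z in snd @^-1` E) (k z)%:E = mu1 E.
Proof.
move=> mE; have mE' : measurable (snd @^-1` E : set (T0 * T1)).
  by rewrite -[X in measurable X]setTI; exact: measurable_snd.
rewrite -[RHS]fineK ?fin_num_measure//; apply: limit_mass_eq => // t n.
have bt := bounded_measurableZ t (bounded_measurable_indic R mE).
apply: le_trans (dual_le_D (bphi n) (bounded_measurableD (bpsi n) bt)).
rewrite le_eqVlt; apply/orP; left; apply/eqP; rewrite /dual_value.
rewrite [in RHS]RintegralD//; try exact: bounded_measurable_integrable.
rewrite RintegralZl//; last exact: bounded_measurable_integrable (bounded_measurable_indic R mE).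
rewrite (_ : \int[mu1]_x \1_E x = fine (mu1 E))%R; last first.
  by rewrite /Rintegral integral_indic// setIT.
rewrite [in RHS](_ : Rintegral nu _ _ = \int[nu]_z (expR (v n z) +
    (expR t - 1) * (\1_(snd @^-1` E) z * expR (v n z))))%R; last first.
  apply: eq_Rintegral => z _ /=; rewrite addrA [LHS]expRD !indicE.
  rewrite (_ : (z \in snd @^-1` E) = (z.2 \in E))//.
  by case: (z.2 \in E) => /=; rewrite ?mulr1 ?mulr0 ?expR0; ring.
by rewrite integral_indicM//; ring.
Qed.

Lemma limit_mass : (\int[nu]_z k z)%R = 1%R.
Proof.
have := limit_marginal_fst measurableT; rewrite preimage_setT probability_setT.
by move=> /(congr1 fine).
Qed.

Lemma cvg_mass : (\int[nu]_z expR (v n z))%R @[n --> \oo] --> (1 : R)%R.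
Proof.
have [_] := cvg_integral_exp measurableT.
rewrite indicT; under eq_fun do under eq_Rintegral do rewrite mul1r.
by under eq_Rintegral do rewrite mul1r; rewrite limit_mass.
Qed.

Lemma cvg_dual : dual (phi n) (psi n) @[n --> \oo] --> D.
Proof.
apply: (@squeeze_cvgr _ _ _ _ (fun n => D - 8^-1 ^+ n)%R (cst D)).
- by apply: nearW => n; rewrite near_max dual_le_D.
- rewrite -[X in _ --> X]subr0; apply: cvgB; first exact: cvg_cst.
  by apply: cvg_expr; rewrite ger0_norm//; lra.
- exact: cvg_cst.
Qed.

(** The linear part is the dual value plus the exponential mass, and the latter tends to 1. This
    produces the constant [D + 1] of the entropy bound. *)
Lemma cvg_potential_integral : J n @[n --> \oo] --> (D + 1)%R.
Proof.
rewrite (_ : (fun n => _) = (fun n => dual (phi n) (psi n) +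
  (\int[nu]_z expR (v n z)))%R); first exact: cvgD cvg_dual cvg_mass.
by apply/funext => n; rewrite /dual_value subrK.
Qed.

End maximizing_sequence.

(** * Entropy of the limit density *)

Lemma measurable_sqrt (R : realType) : measurable_fun [set: R] (@Num.sqrt R).
Proof. exact: continuous_measurable_fun (@sqrt_continuous R). Qed.

(** Provides the nonnegativity that Fatou's lemma needs, uniformly in [s]. For [w < 0], once
    [expR (w / 2)] is factored out, the rest is controlled by [- w * expR (w / 4) <= 4], because
    [1/2 - s >= 1/4]. *)
Lemma scaled_entropy_ge (R : realType) (s w : R) : (0 <= s <= 4^-1)%R ->
  (0 <= w * expR ((1 - s) * w) + 4 * expR (2^-1 * w))%R.
Proof.
move=> /andP[s0 s4]; have [w0|w0] := lerP 0 w.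
  by rewrite addr_ge0// mulr_ge0// expR_ge0.
have -> : ((1 - s) * w = 2^-1 * w + (2^-1 - s) * w)%R by field.
rewrite expRD.
have h1 : (expR ((2^-1 - s) * w) <= expR (4^-1 * w))%R by rewrite ler_expR; nra.
have h2 : (- w * expR (4^-1 * w) <= 4)%R.
  have := expR_ge1Dx (- (4^-1 * w)); rewrite expRN => e1.
  have e0 := expR_gt0 (4^-1 * w).
  have : ((1 - 4^-1 * w) * expR (4^-1 * w) <= 1)%R.
    rewrite (le_trans (ler_wpM2r (ltW e0) e1))// mulVf//.
    by rewrite gt_eqF.
  by nra.
have h3 : (- w * expR ((2^-1 - s) * w) <= 4)%R by nra.
have h4 := expR_ge0 (2^-1 * w).
rewrite (_ : _ + _ = expR (2^-1 * w) * (4 - (- w * expR ((2^-1 - s) * w))))%R; last by ring.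
by apply: mulr_ge0 => //; lra.
Qed.

Section limit_entropy.
Context d0 d1 (T0 : measurableType d0) (T1 : measurableType d1) (R : realType).
Variables (nu : {finite_measure set (T0 * T1)%type -> \bar R}).
Variables (mu0 : probability T0 R) (mu1 : probability T1 R).
Variables (D : R) (phi : (T0 -> R)^nat) (psi : (T1 -> R)^nat).
Hypotheses (bphi : forall n, bounded_measurable (phi n))
  (bpsi : forall n, bounded_measurable (psi n)).
Hypothesis near_max : forall n, (D - 8^-1 ^+ n <= dual_value nu mu0 mu1 (phi n) (psi n))%R.
Hypothesis dual_le_D : forall f g, bounded_measurable f -> bounded_measurable g ->
  (dual_value nu mu0 mu1 f g <= D)%R.

Local Notation dual := (dual_value nu mu0 mu1).
Local Notation v n z := (phi n z.1 + psi n z.2)%R.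
Local Notation J n := (\int[mu0]_x phi n x + \int[mu1]_y psi n y)%R.

Variables (k : (T0 * T1)%type -> R) (g : (T0 * T1)%type -> \bar R).
Hypotheses (mk : measurable_fun setT k) (k0 : forall z, (0 <= k z)%R).
Hypothesis vk : {ae nu, forall z, expR (v n z) @[n --> \oo] --> k z}.
Hypotheses (ig : nu.-integrable setT g)
  (vg : {ae nu, forall z, forall n, (expR (v n z))%:E <= g z}).

Let bv n : bounded_measurable (fun z : (T0 * T1)%type => v n z).
Proof. exact: bounded_measurable_pair. Qed.

(** The scaling parameters tend to 0, but slowly enough that [8^-n / s n], which is [4 * 2^-n], also
    does. The exponent [n.+1] keeps them at most [1/4], as [scaled_entropy_ge] requires. *)
Let s n : R := (4^-1 ^+ n.+1)%R.

Let s01 n : (0 < s n <= 4^-1)%R.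
Proof.
rewrite /s exprn_gt0//= exprS ler_piMr//.
by apply: exprn_ile1 => //; lra.
Qed.

Let bev n (t : R) : bounded_measurable (fun z : (T0 * T1)%type => expR (t * v n z)).
Proof. by apply: bounded_measurable_expR; exact: bounded_measurableZ. Qed.

Let bvev n (t : R) : bounded_measurable (fun z : (T0 * T1)%type => v n z * expR (t * v n z))%R.
Proof. exact: bounded_measurableM. Qed.

(* Comparison of the dual value with the one at the scaled potentials [(1 - s) phi, (1 - s) psi]. *)
Lemma integral_scaled_entropy_le n :
  (\int[nu]_z (v n z * expR ((1 - s n) * v n z)) <= J n + 4 * 2^-1 ^+ n)%R.
Proof.
have /andP[s0 s4] := s01 n.
have := dual_le_D (bounded_measurableZ (1 - s n) (bphi n)) (bounded_measurableZ (1 - s n) (bpsi n)).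
rewrite /dual_value !RintegralZl//; try exact: bounded_measurable_integrable.
have -> : (\int[nu]_z expR ((1 - s n) * phi n z.1 + (1 - s n) * psi n z.2) =
    \int[nu]_z expR ((1 - s n) * v n z))%R.
  by apply: eq_Rintegral => z _; rewrite mulrDr.
have := near_max n; rewrite /dual_value.
set e := (\int[nu]_z expR (v n z))%R; set es := (\int[nu]_z expR ((1 - s n) * v n z))%R.
set I := (\int[nu]_z _)%R.
(* The factor [expR (s v)] of [expR v] is at least [1 + s v]. *)
have he : (es + s n * I <= e)%R.
  rewrite /es /I -RintegralZl//; last exact: bounded_measurable_integrable.
  rewrite -RintegralD//; last 2 first.
  - exact: bounded_measurable_integrable.
  - exact: bounded_measurable_integrable (bounded_measurableZ _ _).
  apply: le_Rintegral => //.
  - exact: bounded_measurable_integrable (bounded_measurableD _ (bounded_measurableZ _ _)).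
  - exact: bounded_measurable_integrable (bounded_measurable_expR _).
  move=> z _; rewrite [leRHS](_ : _ = expR ((1 - s n) * v n z) * expR (s n * v n z))%R; last first.
    by rewrite -expRD; congr expR; ring.
  have := expR_ge1Dx (s n * v n z); have := expR_ge0 ((1 - s n) * v n z).
  by nra.
have e8 : (8^-1 ^+ n = s n * (4 * 2^-1 ^+ n) :> R)%R.
  rewrite /s exprS (_ : 8^-1 = 4^-1 * 2^-1 :> R)%R; last by field.
  by rewrite exprMn; field.
rewrite e8 => h1 h2; rewrite -(ler_pM2l s0); lra.
Qed.

Let measurable_sqrt_k : measurable_fun setT (fun z => Num.sqrt (k z)).
Proof. exact: (measurableT_comp (@measurable_sqrt R) mk). Qed.

(** Controls the term [4 * sqrt k] that makes the entropy integrand nonnegative. The function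
    [1 + g] dominates because a real number is at most one plus its square. *)
Lemma integrable_limit_sqrt :
  nu.-integrable setT (fun z => (Num.sqrt (k z))%:E) /\
  (\int[nu]_z expR (2^-1 * v n z))%R @[n --> \oo] --> (\int[nu]_z Num.sqrt (k z))%R.
Proof.
have i1 : nu.-integrable setT (cst 1).
  by apply: (bounded_measurable_integrable nu (f := cst 1%R)); split => //; exists 1%R => z; rewrite normr1.
have [|||||_ ik cvgk] := @dominated_Rintegral _ _ R nu
    (fun n z => expR (2^-1 * v n z))%R (fun z => Num.sqrt (k z)) (fun z => 1 + g z).
- by move=> n; have [] := bev n 2^-1.
- exact: measurable_sqrt_k.
- apply: filterS vk => z vkz.
  rewrite (_ : (fun n => _) = (fun n => Num.sqrt (expR (v n z)))).
    by apply: (cvg_comp _ _ vkz); exact: sqrt_continuous.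
  apply/funext => n; rewrite (_ : expR (v n z) = (expR (2^-1 * v n z)) ^+ 2)%R.
    by rewrite sqrtr_sqr ger0_norm// expR_ge0.
  by rewrite -expRM_natl; congr expR; field.
- exact: integrableD.
- apply: filterS vg => z + n => /(_ n) vgn.
  rewrite ger0_norm ?expR_ge0//.
  apply: (@le_trans _ _ (1 + (expR (v n z))%:E)); last by rewrite leeD2l.
  rewrite -EFinD lee_fin (_ : expR (v n z) = (expR (2^-1 * v n z)) ^+ 2)%R; last first.
    by rewrite -expRM_natl; congr expR; field.
  by have := sqr_ge0 (expR (2^-1 * v n z) - 2^-1)%R; nra.
by split.
Qed.

(** Fatou's lemma for the functions [F n], which are nonnegative by [scaled_entropy_ge] and whose
    integrals are bounded through [integral_scaled_entropy_le]. The square-root term is subtracted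
    again at the end. *)
Lemma limit_entropy_le : nu.-integrable setT (fun z => (ln (k z) * k z)%:E) /\
  (\int[nu]_z (ln (k z) * k z) <= D + 1)%R.
Proof.
have [isq cvgsq] := integrable_limit_sqrt.
have sqrtE z : (0 < k z)%R -> expR (2^-1 * ln (k z)) = Num.sqrt (k z).
  move=> kz; apply/eqP; rewrite -(@eqrXn2 _ 2) ?sqrtr_ge0 ?expR_ge0// sqr_sqrtr ?ltW//.
  by rewrite -expRM_natl mulrA divff// mul1r lnK.
have F0 z : (0 <= ln (k z) * k z + 4 * Num.sqrt (k z))%R.
  have := k0 z; rewrite le_eqVlt => /predU1P[<-|kz].
    by rewrite mulr0 sqrtr0 mulr0 addr0.
  have := @scaled_entropy_ge R 0 (ln (k z)).
  by rewrite lexx invr_ge0 ler0n subr0 mul1r lnK ?posrE// sqrtE// => /(_ isT).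
have mlk : measurable_fun setT (fun z => ln (k z) * k z)%R.
  by apply: measurable_funM => //; exact: measurableT_comp.
have msk := measurable_sqrt_k.
have le1 : \int[nu]_z (ln (k z) * k z + 4 * Num.sqrt (k z))%:E <=
    (D + 1 + 4 * \int[nu]_z Num.sqrt (k z))%R%:E.
  pose F n z := (v n z * expR ((1 - s n) * v n z) + 4 * expR (2^-1 * v n z))%R.
  have bF n : bounded_measurable (F n).
    by apply: bounded_measurableD => //; exact: bounded_measurableZ.
  have mF n : measurable_fun setT (F n) by have [] := bF n.
  have mEF n : measurable_fun setT (EFin \o F n) by exact/measurable_EFinP.
  have Fn0 n z : 0 <= (EFin \o F n) z.
    by rewrite lee_fin; apply: scaled_entropy_ge; have /andP[/ltW -> ->] := s01 n.
  have s_0 : s n @[n --> \oo] --> (0 : R)%R.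
    rewrite -[X in _ --> X](mulr0 (4^-1)%R); under eq_fun do rewrite /s exprS.
    by apply: cvgM; [exact: cvg_cst|apply: cvg_expr; rewrite ger0_norm//; lra].
  apply: (@fatou_ae_le _ _ _ nu (fun n => EFin \o F n) _ (fun n => (J n + 4 * 2^-1 ^+ n +
      4 * \int[nu]_z expR (2^-1 * v n z))%R)) => //.
  - by apply/measurable_EFinP/measurable_funD => //; exact: measurable_funM.
  - apply: filterS vk => z vkz.
    have := k0 z; rewrite le_eqVlt => /predU1P[kz|kz].
      (* Where [k z = 0] the target value is 0, so nonnegativity of the [F n] suffices. *)
      by rewrite -kz mulr0 sqrtr0 mulr0 addr0; exact: limn_einf_ge0.
    have vln : v n z @[n --> \oo] --> ln (k z).
      rewrite (_ : (fun n => _) = (fun n => ln (expR (v n z)))).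
        by apply: (cvg_comp _ _ vkz); exact: continuous_ln.
      by apply/funext => n; rewrite expRK.
    have sln : ((1 - s n) * v n z)%R @[n --> \oo] --> ln (k z).
      rewrite (_ : ln (k z) = (1 - 0) * ln (k z))%R; last by rewrite subr0 mul1r.
      by apply: cvgM => //; apply: cvgB => //; exact: cvg_cst.
    have cF : (F n z)%:E @[n --> \oo] --> (ln (k z) * k z + 4 * Num.sqrt (k z))%:E.
      apply: cvg_EFin; first exact: nearW.
      rewrite /F/=; apply: cvgD.
        apply: cvgM => //; rewrite -[X in _ --> X](lnK kz).
        by apply: (cvg_comp _ _ sln); exact: continuous_expR.
      apply: cvgM; first exact: cvg_cst.
      rewrite -sqrtE//; apply: (cvg_comp _ expR); last exact: continuous_expR.
      by apply: cvgM => //; exact: cvg_cst.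
    by rewrite (cvg_limn_einf_sup cF).1.
  - move=> n; rewrite -[leLHS]fineK; last first.
      by apply: integrable_fin_num => //; exact: bounded_measurable_integrable.
    rewrite lee_fin -/(Rintegral _ _ _) RintegralD//; last 2 first.
      exact: bounded_measurable_integrable.
      exact: bounded_measurable_integrable (bounded_measurableZ _ _).
    rewrite RintegralZl//; last exact: bounded_measurable_integrable.
    by rewrite lerD2r integral_scaled_entropy_le.
  - apply: cvgD; last by apply: cvgM => //; exact: cvg_cst.
    rewrite (_ : D + 1 = D + 1 + 4 * 0)%R; last by rewrite mulr0 addr0.
    apply: cvgD.
      exact: (cvg_potential_integral bphi bpsi near_max dual_le_D mk k0 vk ig vg).
    by apply: cvgM; [exact: cvg_cst|apply: cvg_expr; rewrite ger0_norm//; lra].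
have i4 : nu.-integrable setT (fun z => (4 * Num.sqrt (k z))%:E).
  by under eq_fun do rewrite EFinM; exact: integrableZl.
have iF : nu.-integrable setT (fun z => (ln (k z) * k z + 4 * Num.sqrt (k z))%:E).
  apply/integrableP; split.
    by apply/measurable_EFinP/measurable_funD => //; exact: measurable_funM.
  under eq_integral do rewrite gee0_abs ?lee_fin//.
  exact: le_lt_trans le1 (ltry _).
have ilk : nu.-integrable setT (fun z => (ln (k z) * k z)%:E).
  rewrite (_ : (fun z => _) = (fun z => (ln (k z) * k z + 4 * Num.sqrt (k z))%:E) \-
    (fun z => (4 * Num.sqrt (k z))%:E)); first exact: integrableB.
  by apply/funext => z; rewrite /= -EFinB addrK.
split => //; move: le1; rewrite -[leLHS]fineK; last exact: integrable_fin_num.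
rewrite lee_fin -/(Rintegral _ _ _) RintegralD// RintegralZl//.
by rewrite lerD2r.
Qed.

End limit_entropy.

(** * Product form of the limit density *)

Section limit_product.
Context d0 d1 (T0 : measurableType d0) (T1 : measurableType d1) (R : realType).
Variables (nu : {finite_measure set (T0 * T1)%type -> \bar R}).
Variables (mu0 : probability T0 R) (mu1 : probability T1 R).
Variables (G0 : T0 -> R) (G1 : T1 -> R).
Hypotheses (iG0 : mu0.-integrable setT (EFin \o G0))
  (iG1 : mu1.-integrable setT (EFin \o G1)).
Hypothesis nu_ge : forall F : (T0 * T1)%type -> \bar R,
  measurable_fun setT F -> (forall z, 0 <= F z) ->
  \int[mu0 \x mu1]_z (F z * (expR (- (G0 z.1 + G1 z.2)))%:E) <= \int[nu]_z F z.

Local Notation dual := (dual_value nu mu0 mu1).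

(** When [nu_ge] is tested on the indicator of a [nu]-null set, a positive function has integral 0
    over that set. *)
Lemma product_dominates : (mu0 \x mu1) `<< nu.
Proof.
apply/null_content_dominatesP => E mE nuE0.
have mG : measurable_fun setT (fun z : (T0 * T1)%type => (expR (- (G0 z.1 + G1 z.2)))%:E).
  apply/measurable_EFinP/measurableT_comp => //; apply: measurableT_comp => //.
  apply: measurable_funD; apply: measurableT_comp => //; apply/measurable_EFinP.
    exact: measurable_int iG0.
  exact: measurable_int iG1.
have := nu_ge (F := fun z => (\1_E z)%:E).
rewrite integral_indic// setIT nuE0 => /(_ _ _)/wrap[].
- by apply/measurable_EFinP; exact: measurable_indic.
- by move=> z; rewrite lee_fin.
move=> h0.
apply: (measure0_integral0 mG) => // [z|]; first by rewrite lte_fin expR_gt0.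
apply/eqP; rewrite eq_le integral_ge0 ?andbT//; apply: le_trans h0.
rewrite integral_mkcond le_eqVlt; apply/orP; left; apply/eqP.
by apply: eq_integral => z _; rewrite epatch_indic muleC.
Qed.

Variables (D : R) (phi : (T0 -> R)^nat) (psi : (T1 -> R)^nat).
Hypotheses (bphi : forall n, bounded_measurable (phi n))
  (bpsi : forall n, bounded_measurable (psi n)).
Hypothesis near_max : forall n, (D - 8^-1 ^+ n <= dual (phi n) (psi n))%R.

Local Notation v n z := (phi n z.1 + psi n z.2)%R.

Variables (k : (T0 * T1)%type -> R).
Hypotheses (mk : measurable_fun setT k) (k0 : forall z, (0 <= k z)%R).
Hypothesis vk : {ae nu, forall z, expR (v n z) @[n --> \oo] --> k z}.

Let gap n z : \bar R := (expR (v n z - (G0 z.1 + G1 z.2)) -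
     (1 + (v n z - (G0 z.1 + G1 z.2))))%:E.

(** The integrals of the nonnegative functions [gap n] are bounded, so by Fatou's lemma their lower
    limit is finite almost everywhere. Where [k z = 0], however, [v n z] tends to [-oo] and
    [gap n z] to [+oo]. *)
Lemma limit_gt0 : {ae mu0 \x mu1, forall z, (0 < k z)%R}.
Proof.
have mG : measurable_fun setT (fun z : (T0 * T1)%type => (G0 z.1 + G1 z.2)%R).
  apply: measurable_funD; apply: measurableT_comp => //; apply/measurable_EFinP.
    exact: measurable_int iG0.
  exact: measurable_int iG1.
have mv n : measurable_fun setT (fun z : (T0 * T1)%type => v n z).
  by have [] := bounded_measurable_pair (bphi n) (bpsi n).
have mgap n : measurable_fun setT (gap n).
  apply/measurable_EFinP/measurable_funB.
    by apply: measurableT_comp => //; exact: measurable_funB.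
  by apply: measurable_funD => //; exact: measurable_funB.
have gap0 n z : 0 <= gap n z by rewrite lee_fin subr_ge0 expR_ge1Dx.
(* Since [8^-n <= 1], every dual value of the sequence is at least [D - 1]. *)
pose C := (\int[mu0]_x G0 x + \int[mu1]_y G1 y - 1 - (D - 1))%R.
have gapC n : \int[mu0 \x mu1]_z gap n z <= C%:E.
  apply: le_trans (integral_dual_gap iG0 iG1 nu_ge (bphi n) (bpsi n)) _.
  rewrite lee_fin lerD2l lerN2 (le_trans _ (near_max n))// lerD2l lerN2.
  by apply: exprn_ile1 => //; lra.
have := @fatou_le _ _ R (mu0 \x mu1) gap (cst C) C mgap gap0 gapC => /(_ _)/wrap[|limC].
  exact: cvg_cst.
have ilim : (mu0 \x mu1).-integrable setT (fun z => limn_einf (gap ^~ z)).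
  apply/integrableP; split; first exact: measurable_fun_limn_einf.
  under eq_integral do rewrite gee0_abs ?limn_einf_ge0//.
  exact: le_lt_trans limC (ltry _).
apply: filterS2 (integrable_ae measurableT ilim) (ae_dominates product_dominates vk).
move=> z /(_ I) + vkz; have := k0 z; rewrite le_eqVlt => /predU1P[kz|//].
suff gapy : gap n z @[n --> \oo] --> +oo by rewrite (cvg_limn_einf_sup gapy).1.
apply/cvgeyPge => M.
have : \forall n \near \oo, (expR (v n z) < expR (G0 z.1 + G1 z.2 - (`|M| + 1)))%R.
  by apply: (cvgr_lt _ vkz); rewrite -kz expR_gt0.
apply: filterS => n; rewrite ltr_expR => vM; rewrite lee_fin.
have := expR_ge0 (v n z - (G0 z.1 + G1 z.2)); have := ler_norm M.
by lra.
Qed.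

Hypotheses
  (k_fst : forall E, measurable E -> \int[nu]_(z in fst @^-1` E) (k z)%:E = mu0 E)
  (k_snd : forall E, measurable E -> \int[nu]_(z in snd @^-1` E) (k z)%:E = mu1 E).

Lemma ae_null_set (E : set (T0 * T1)%type) : measurable E ->
  \int[nu]_(z in E) (k z)%:E = 0 -> {ae nu, forall z, E z -> k z = 0%R}.
Proof.
move=> mE kE0.
have h1 : \int[nu]_(z in E) `|(k z)%:E| = 0.
  by under eq_integral do rewrite gee0_abs ?lee_fin//.
have mkE : measurable_fun E (EFin \o k) by apply/measurable_EFinP/measurable_funTS.
have := (ae_eq_integral_abs _ mE mkE).1 h1.
by apply: filterS => z /[apply] /= [[]].
Qed.

(** Writes [expR (v n)] as [expR (phi n x - phi n x0)] times [expR (phi n x0 + psi n y)] for a fixed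
    [x0]; each factor converges off a null set of one variable. These sets are null for [mu0] and
    [mu1], while the factorization is claimed [nu]-almost everywhere, so the exceptional fibres are
    treated through the marginals of [k nu]. *)
Lemma limit_product : exists (f : T0 -> R) (g : T1 -> R),
  [/\ measurable_fun setT f, measurable_fun setT g,
    (forall x, 0 <= f x)%R, (forall y, 0 <= g y)%R &
    {ae nu, forall z, k z = f z.1 * g z.2}%R].
Proof.
have : {ae mu0 \x mu1, forall z, exists2 l : R, (0 < l)%R & expR (v n z) @[n --> \oo] --> l}.
  apply: filterS2 limit_gt0 (ae_dominates product_dominates vk) => z kz vkz.
  by exists (k z).
case=> N [mN QN0 NP].
have cvgN z : ~ N z -> exists2 l : R, (0 < l)%R & expR (v n z) @[n --> \oo] --> l.
  by move=> Nz; apply: contrapT => h; exact/Nz/NP.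
have mNx x : measurable (xsection N x) by exact: measurable_xsection.
have : {ae mu0, forall x, mu1 (xsection N x) = 0}.
  have mx : measurable_fun setT (mu1 \o xsection N) by exact: measurable_fun_xsection.
  have /(ae_eq_integral_abs _ measurableT mx).1 : \int[mu0]_x `|(mu1 \o xsection N) x| = 0.
    by under eq_integral do rewrite gee0_abs ?measure_ge0//.
  by apply: filterS => x /(_ I).
case=> N0 [mN0 mu0N0 N0P].
have sec0 x : ~ N0 x -> mu1 (xsection N x) = 0.
  by move=> Nx; apply: contrapT => h; exact/Nx/N0P.
have ex_notin d (T : measurableType d) (p : probability T R) (E : set T) :
    measurable E -> p E = 0 -> exists x, ~ E x.
  move=> mE pE; apply: contrapT => /forallNP h.
  have ET : E = setT by rewrite -subTset => x _; apply: contrapT; exact: h.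
  by move: pE; rewrite ET probability_setT => /eqP; rewrite onee_eq0.
(* The base point of the normalization: the section of [N] over it is [mu1]-null. *)
have [x0 Nx0] := ex_notin _ _ mu0 _ mN0 mu0N0.
pose N1 := xsection N x0.
(* Two null sections leave some [y] outside both; [psi n y] then cancels in the quotient of the
   limits at [(x, y)] and [(x0, y)]. *)
have cvgF x : ~ N0 x -> exists2 l : R, (0 < l)%R &
    expR (phi n x - phi n x0) @[n --> \oo] --> l.
  move=> Nx; have U0 : mu1 (N1 `|` xsection N x) = 0.
    by apply: null_set_setU; [exact: mNx|exact: mNx|exact: sec0|exact: sec0].
  have [y] := ex_notin _ _ mu1 _ (measurableU _ _ (mNx x0) (mNx x)) U0.
  move=> /not_orP[yx0 yx].
  have [a a0 ca] : exists2 l : R, (0 < l)%R & expR (v n (x0, y)) @[n --> \oo] --> l.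
    by apply: cvgN => h; apply: yx0; rewrite /N1 /xsection/= inE.
  have [b b0 cb] : exists2 l : R, (0 < l)%R & expR (v n (x, y)) @[n --> \oo] --> l.
    by apply: cvgN => h; apply: yx; rewrite /xsection/= inE.
  exists (b / a)%R; first by rewrite divr_gt0.
  rewrite (_ : (fun n => _) = (fun n => expR (v n (x, y)) / expR (v n (x0, y)))%R).
    by apply: cvgM => //; apply: cvgV => //; rewrite gt_eqF.
  by apply/funext => n; rewrite -expRN -expRD/=; congr expR; ring.
have cvgG y : ~ N1 y -> exists2 l : R, (0 < l)%R &
    expR (phi n x0 + psi n y) @[n --> \oo] --> l.
  move=> Ny; have [|l l0 cl] := cvgN (x0, y); last by exists l.
  by move=> h; apply: Ny; rewrite /N1 /xsection/= inE.
have mphi n : measurable_fun setT (phi n) by have [] := bphi n.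
have mpsi n : measurable_fun setT (psi n) by have [] := bpsi n.
have [||f [mf cf f0]] := @measurable_limit_off _ T0 R
  (fun n x => expR (phi n x - phi n x0))%R N0 _ mN0.
- by move=> n; apply: measurableT_comp => //; exact: measurable_funB.
- by move=> x /cvgF[l _ cl]; exact: cvgP cl.
have [||g [mg cg g0]] := @measurable_limit_off _ T1 R
  (fun n y => expR (phi n x0 + psi n y))%R N1 _ (mNx x0).
- by move=> n; apply: measurableT_comp => //; exact: measurable_funD.
- by move=> y /cvgG[l _ cl]; exact: cvgP cl.
exists f, g; split => //.
- move=> x; have [xN|xN] := pselect (N0 x); first by rewrite f0.
  rewrite -(cvg_lim _ (cf x xN))//; apply: limr_ge; first exact: cvgP (cf x xN).
  by apply: nearW => n; exact: expR_ge0.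
- move=> y; have [yN|yN] := pselect (N1 y); first by rewrite g0.
  rewrite -(cvg_lim _ (cg y yN))//; apply: limr_ge; first exact: cvgP (cg y yN).
  by apply: nearW => n; exact: expR_ge0.
have mN0' : measurable (fst @^-1` N0 : set (T0 * T1)%type).
  by rewrite -[X in measurable X]setTI; exact: measurable_fst.
have mN1' : measurable (snd @^-1` N1 : set (T0 * T1)%type).
  by rewrite -[X in measurable X]setTI; apply: measurable_snd => //; exact: mNx.
(* The first marginal of [k nu] is [mu0], which gives [N0] no mass. Hence [k] vanishes [nu]-almost
   everywhere above [N0], in agreement with the value 0 of [f] there; likewise for [N1] and [g]. *)
have k_N0 : {ae nu, forall z, N0 z.1 -> k z = 0%R}.
  by apply: ae_null_set => //; rewrite k_fst.
have k_N1 : {ae nu, forall z, N1 z.2 -> k z = 0%R}.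
  by apply: ae_null_set => //; rewrite k_snd; [exact: sec0|exact: mNx].
apply: filterS3 k_N0 k_N1 vk => z kN0 kN1 vkz.
have [zN0|zN0] := pselect (N0 z.1); first by rewrite kN0// f0// mul0r.
have [zN1|zN1] := pselect (N1 z.2); first by rewrite kN1// g0// mulr0.
apply: (cvg_unique _ vkz) => //.
rewrite (_ : (fun n => _) = (fun n => expR (phi n z.1 - phi n x0) *
  expR (phi n x0 + psi n z.2))%R); first by apply: cvgM; [exact: cf|exact: cg].
by apply/funext => n; rewrite -expRD; congr expR; ring.
Qed.

End limit_product.

Lemma schrodinger_potentials d0 d1 (T0 : measurableType d0)
    (T1 : measurableType d1) (R : realType)
    (nu : {finite_measure set (T0 * T1)%type -> \bar R})
    (mu0 : probability T0 R) (mu1 : probability T1 R)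
    (G0 : T0 -> R) (G1 : T1 -> R) :
  mu0.-integrable setT (EFin \o G0) -> mu1.-integrable setT (EFin \o G1) ->
  (forall F : (T0 * T1)%type -> \bar R,
    measurable_fun setT F -> (forall z, 0 <= F z) ->
    \int[mu0 \x mu1]_z (F z * (expR (- (G0 z.1 + G1 z.2)))%:E) <=
      \int[nu]_z F z) ->
  exists (f : T0 -> R) (g : T1 -> R) (phi : (T0 -> R)^nat)
    (psi : (T1 -> R)^nat) (L : R),
    [/\ [/\ measurable_fun setT f, measurable_fun setT g,
            (forall x, 0 <= f x)%R & (forall y, 0 <= g y)%R],
        (forall n, bounded_measurable (phi n)) /\
          (forall n, bounded_measurable (psi n)),
        [/\ {ae nu, forall z,
              expR (phi n z.1 + psi n z.2) @[n --> \oo] --> (f z.1 * g z.2)%R},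
            (\int[nu]_z expR (phi n z.1 + psi n z.2))%R @[n --> \oo] --> (1 : R)%R &
            (\int[mu0]_x phi n x + \int[mu1]_y psi n y)%R @[n --> \oo] --> L],
        (forall E, measurable E ->
          \int[nu]_(z in fst @^-1` E) (f z.1 * g z.2)%:E = mu0 E) /\
        (forall E, measurable E ->
          \int[nu]_(z in snd @^-1` E) (f z.1 * g z.2)%:E = mu1 E) &
        nu.-integrable setT
          (fun z => (ln (f z.1 * g z.2) * (f z.1 * g z.2))%:E) /\
        (\int[nu]_z (ln (f z.1 * g z.2) * (f z.1 * g z.2)) <= L)%R].
Proof.
move=> iG0 iG1 nu_ge.
have [D [phi [psi [bphi bpsi near_max dual_le_D]]]] :=
  dual_maximizing_sequence iG0 iG1 nu_ge.
have [k [w [mk k0 vk iw vw]]] := exp_maximizing_cvg bphi bpsi near_max dual_le_D.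
have [f [g [mf mg f0 g0 kfg]]] := limit_product iG0 iG1 nu_ge bphi bpsi near_max
  mk k0 vk (limit_marginal_fst bphi bpsi near_max dual_le_D mk k0 vk iw vw)
  (limit_marginal_snd bphi bpsi near_max dual_le_D mk k0 vk iw vw).
pose h (z : (T0 * T1)%type) := (f z.1 * g z.2)%R.
have mh : measurable_fun setT h.
  by apply: measurable_funM; exact: measurableT_comp.
have h0 z : (0 <= h z)%R by rewrite mulr_ge0.
(* The product [h] is a limit of the same sequence, so the results on marginals, mass and entropy
   apply to [h] itself in place of [k]. *)
have vh : {ae nu, forall z, expR (phi n z.1 + psi n z.2) @[n --> \oo] --> h z}.
  by apply: filterS2 kfg vk => z kz; rewrite kz.
exists f, g, phi, psi, (D + 1)%R; split => //.
- split => //.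
  + exact: (cvg_mass bphi bpsi near_max dual_le_D mh h0 vh iw vw).
  + exact: (cvg_potential_integral bphi bpsi near_max dual_le_D mh h0 vh iw vw).
- split.
  + exact: (limit_marginal_fst bphi bpsi near_max dual_le_D mh h0 vh iw vw).
  + exact: (limit_marginal_snd bphi bpsi near_max dual_le_D mh h0 vh iw vw).
- exact: (limit_entropy_le bphi bpsi near_max dual_le_D mh h0 vh iw vw).
Qed.

(** * A sufficient condition for optimality *)

(** For [p > 0], expanding the square and dividing by [2 * p] reduces the claim to [1 + w <= expR w]
    at [w = u / 2 - ln (sqrt p)]. *)
Lemma entropy_hellinger (R : realType) (p u : R) : (0 <= p)%R ->
  ((Num.sqrt p - expR (2^-1 * u)) ^+ 2 <= (ln p - u - 1) * p + expR u)%R.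
Proof.
have -> : expR u = (expR (2^-1 * u) ^+ 2)%R.
  by rewrite -expRM_natl; congr expR; field.
rewrite le_eqVlt => /predU1P[<-|p0].
  by rewrite sqrtr0 mulr0 sub0r sqrrN add0r.
have pE : (p = Num.sqrt p ^+ 2)%R by rewrite sqr_sqrtr// ltW.
have s0 : (0 < Num.sqrt p)%R by rewrite sqrtr_gt0.
have lnE : (ln p = 2 * ln (Num.sqrt p))%R by rewrite {1}pE lnXn// mulr_natl.
have h1 : (1 + (2^-1 * u - ln (Num.sqrt p)) <= expR (2^-1 * u) / Num.sqrt p)%R.
  rewrite (le_trans (expR_ge1Dx _))// expRD expRN lnK ?posrE//.
have h2 : ((1 + (2^-1 * u - ln (Num.sqrt p))) * Num.sqrt p <= expR (2^-1 * u))%R.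
  by rewrite -ler_pdivlMr.
rewrite lnE {3}pE; nra.
Qed.

Section integral_parts.
Context d (T : measurableType d) (R : realType) (p : {measure set T -> \bar R}).
Implicit Types f : T -> \bar R.

Lemma integral_funeneg_lty f : p.-integrable setT f -> \int[p]_x f^\- x < +oo.
Proof.
move=> /(integrable_funeneg measurableT) i.
by rewrite ltey_eq integrable_fin_num.
Qed.

Lemma integrable_of_funeneg f : measurable_fun setT f ->
  \int[p]_x f^\- x < +oo -> \int[p]_x f x < +oo -> p.-integrable setT f.
Proof.
move=> mf fnoo foo; apply/integrableP; split => //.
under eq_integral => x _ do rewrite -/((abse \o f) x) fune_abse.
have fn_fin : \int[p]_x f^\- x \is a fin_num.
  by rewrite ge0_fin_numE// integral_ge0.
rewrite ge0_integralD//; [|exact: measurable_funepos|exact: measurable_funeneg].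
rewrite lte_add_pinfty//; move: foo; rewrite integralE -(fineK fn_fin).
by case: (\int[p]_x f^\+ x) => [s _||//]; rewrite ?ltry.
Qed.

End integral_parts.

(** The default value [+oo] is excluded, so the negative part of the logarithm is integrable; as the
    integral is below [+oo], so is the positive part. *)
Lemma entropy_lty d (T : measurableType d) (R : realType) (p : probability T R)
    (r : {sigma_finite_measure set T -> \bar R}) : entropy p r < +oo ->
  [/\ is_density p r (rn_deriv p r),
      p.-integrable setT (fun x => (ln (rn_deriv p r x))%:E) &
      entropy p r = \int[p]_x (ln (rn_deriv p r x))%:E].
Proof.
rewrite /entropy; case: asboolP => [[pr lneg]|//] lnlt.
have den : is_density p r (rn_deriv p r) by exact: rn_deriv_density.
split => //; have [mp _ _] := den.
have mln : measurable_fun setT (fun x => (ln (rn_deriv p r x))%:E).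
  exact/measurable_EFinP/measurableT_comp.
exact: integrable_of_funeneg.
Qed.

Section optimality.
Context d (T : measurableType d) (R : realType).
Variables (r : {sigma_finite_measure set T -> \bar R}) (S : set (probability T R)).
Variables (Phat : probability T R) (h : T -> R) (u : (T -> R)^nat) (c : R^nat) (L : R).
Hypotheses (SPhat : S Phat) (mh : measurable_fun setT h) (h0 : forall x, (0 <= h x)%R).
Hypothesis PhatE : measure_eq Phat (with_density h r).
Hypothesis mu : forall n, measurable_fun setT (u n).
Hypothesis uS : forall n (P : probability T R), S P ->
  P.-integrable setT (EFin \o u n) /\ \int[P]_x (u n x)%:E = (c n)%:E.
Hypothesis cL : c n @[n --> \oo] --> L.
Hypothesis iexpu : forall n, r.-integrable setT (fun x => (expR (u n x))%:E).
Hypothesis mass : (\int[r]_x expR (u n x))%R @[n --> \oo] --> (1 : R)%R.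
Hypothesis uh : {ae r, forall x, expR (u n x) @[n --> \oo] --> h x}.
Hypotheses (ilnh : Phat.-integrable setT (fun x => (ln (h x))%:E))
  (lnhL : \int[Phat]_x (ln (h x))%:E <= L%:E).

Let Phat_r : Phat `<< r.
Proof.
apply: (@dominates_density _ _ _ r Phat (EFin \o h)) => //.
exact/measurable_EFinP.
Qed.

(** The density chosen by [rn_deriv] may differ from [h], but both agree [r]-almost everywhere,
    hence [Phat]-almost everywhere. *)
Lemma entropy_minimizer : entropy Phat r = \int[Phat]_x (ln (h x))%:E.
Proof.
have [mp p0 pE] := rn_deriv_density Phat_r.
have ih : r.-integrable setT (EFin \o h).
  apply/integrableP; split; first exact/measurable_EFinP.
  under eq_integral do rewrite gee0_abs ?lee_fin//.
  by have := PhatE measurableT; rewrite /with_density => <-; rewrite probability_setT ltry.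
have hp : ae_eq r setT (EFin \o h) (EFin \o rn_deriv Phat r).
  apply: integral_ae_eq => //; first exact/measurable_EFinP.
  by move=> E _ mE; rewrite -[LHS]PhatE// pE.
have lnp : ae_eq Phat setT (fun x => (ln (h x))%:E) (fun x => (ln (rn_deriv Phat r x))%:E).
  apply: (ae_dominates Phat_r); apply: filterS hp => x /(_ I) hpx _.
  by case: hpx => ->.
have mlnp : measurable_fun setT (fun x => (ln (rn_deriv Phat r x))%:E).
  exact/measurable_EFinP/measurableT_comp.
have mlnh := measurable_int _ ilnh.
rewrite /entropy asboolT.
  by apply: ae_eq_integral => //; apply: filterS lnp => x ->.
split => //; apply: le_lt_trans (integral_funeneg_lty ilnh).
rewrite le_eqVlt; apply/orP; left; apply/eqP; apply: ae_eq_integral => //.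
- exact: measurable_funeneg.
- exact: measurable_funeneg.
- by apply: filterS lnp => x /(_ I) hx _; rewrite !funenegE hx.
Qed.

(** Integrate [entropy_hellinger] with [u = u n]: the linear term is [c n] for every competitor, and
    the exponential mass tends to 1. The upper bounds thus tend to the entropy minus [L], and
    Fatou's lemma passes to the limit on the left. *)
Lemma hellinger_le_entropy (P : probability T R) : S P -> entropy P r < +oo ->
  [/\ is_density P r (rn_deriv P r), entropy P r \is a fin_num &
   \int[r]_x ((Num.sqrt (rn_deriv P r x) - Num.sqrt (h x)) ^+ 2)%:E <= entropy P r - L%:E].
Proof.
move=> SP /entropy_lty[den ilnp ->]; have [mp p0 pE] := den.
set p := rn_deriv P r in den ilnp mp p0 pE *.
set H := fine (\int[P]_x (ln (p x))%:E).
have HE : \int[P]_x (ln (p x))%:E = H%:E by rewrite fineK// integrable_fin_num.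
split => //; first by rewrite HE.
rewrite HE -EFinB.
pose F n x := ((Num.sqrt (p x) - expR (2^-1 * u n x)) ^+ 2)%R.
have msqrt (f : T -> R) : measurable_fun setT f ->
    measurable_fun setT (fun x => Num.sqrt (f x)).
  by move=> mf; exact: (measurableT_comp (@measurable_sqrt R) mf).
apply: (@fatou_ae_le _ _ _ r (fun n x => (F n x)%:E) _
  (fun n => H - c n - 1 + \int[r]_x expR (u n x))%R).
- move=> n; apply/measurable_EFinP/measurable_funX/measurable_funB; first exact: msqrt.
  by apply: measurableT_comp => //; exact: measurable_funM.
- by move=> n x; rewrite lee_fin sqr_ge0.
- by apply/measurable_EFinP/measurable_funX/measurable_funB; exact: msqrt.
- by move=> x; rewrite lee_fin sqr_ge0.
- apply: filterS uh => x uhx.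
  suff cF : (F n x)%:E @[n --> \oo] --> ((Num.sqrt (p x) - Num.sqrt (h x)) ^+ 2)%:E.
    by rewrite (cvg_limn_einf_sup cF).1.
  apply: cvg_EFin; first exact: nearW.
  rewrite /F/= expr2; under eq_fun do rewrite expr2.
  have cs : expR (2^-1 * u n x) @[n --> \oo] --> Num.sqrt (h x).
    rewrite (_ : (fun n => _) = (fun n => Num.sqrt (expR (u n x)))).
      by apply: (cvg_comp _ _ uhx); exact: sqrt_continuous.
    apply/funext => n; rewrite (_ : expR (u n x) = (expR (2^-1 * u n x)) ^+ 2)%R.
      by rewrite sqrtr_sqr ger0_norm// expR_ge0.
    by rewrite -expRM_natl; congr expR; field.
  by apply: cvgM; apply: cvgB => //; exact: cvg_cst.
- move=> n; have [iu uE] := uS n SP.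
  have i1 : P.-integrable setT (cst 1).
    by apply: (bounded_measurable_integrable P (f := cst 1%R)); split => //; exists 1%R => z; rewrite normr1.
  have iw : P.-integrable setT (EFin \o (fun x => ln (p x) - u n x - 1)%R).
    by rewrite /comp; under eq_fun do rewrite !EFinB; apply: integrableB => //; exact: integrableB.
  have mw : measurable_fun setT (fun x => ln (p x) - u n x - 1)%R.
    by apply/measurable_EFinP; exact: measurable_int iw.
  have irw := (integrable_density mp p0 pE mw).2 iw.
  have wE := integral_density mp p0 pE mw.
  apply: (@le_trans _ _ (\int[r]_x (((ln (p x) - u n x - 1) * p x)%:E + (expR (u n x))%:E))).
    have irwu := integrableD measurableT irw (iexpu n).
    apply: ge0_le_integral => //.
    + by move=> x _; rewrite lee_fin sqr_ge0.
    + apply/measurable_EFinP/measurable_funX/measurable_funB; first exact: msqrt.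
      by apply: measurableT_comp => //; exact: measurable_funM.
    + exact: measurable_int irwu.
    + by move=> x _; rewrite -EFinD lee_fin; exact: entropy_hellinger.
  rewrite integralD// -wE.
  under eq_integral do rewrite !EFinB.
  rewrite integralB//; last exact: integrableB.
  have P1 : \int[P]_x 1 = 1 by rewrite integral_cst// mul1e; exact: probability_setT.
  rewrite integralB// HE uE P1.
  rewrite EFinD !EFinB -HE /Rintegral fineK; last exact: integrable_fin_num.
  exact: lexx.
- rewrite (_ : (H - L = H - L - 1 + 1)%R); last by rewrite subrK.
  apply: cvgD => //; apply: cvgB; last exact: cvg_cst.
  by apply: cvgB => //; exact: cvg_cst.
Qed.

(** A squared distance is nonnegative, so [L] bounds every entropy from below, while that of [Phat]
    is at most [L]. Another solution then has squared distance 0 to [h], hence the same density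
    almost everywhere. *)
Lemma density_unique_solution : unique_solution r S Phat.
Proof.
have ePhat : entropy Phat r = (fine (\int[Phat]_x (ln (h x))%:E))%:E.
  by rewrite entropy_minimizer fineK// integrable_fin_num.
have ePhatL : entropy Phat r <= L%:E by rewrite entropy_minimizer.
have hell_ge0 (P : probability T R) :
    0 <= \int[r]_x ((Num.sqrt (rn_deriv P r x) - Num.sqrt (h x)) ^+ 2)%:E.
  by apply: integral_ge0 => x _; rewrite lee_fin sqr_ge0.
split.
  split => //; first by rewrite ePhat.
  move=> P SP; have [ey|/eqP ey] := pselect (entropy P r = +oo); first by rewrite ey leey.
  have [|_ efin] := hellinger_le_entropy SP; first by rewrite ltey.
  move=> /(le_trans (hell_ge0 P)); rewrite sube_ge0 ?efin ?orbT//.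
  exact: le_trans.
move=> P [SP efin /(_ _ SPhat) eP] E mE.
have [|[mp p0 pE] _] := hellinger_le_entropy SP; first by rewrite ltey_eq efin.
set p := rn_deriv P r in mp p0 pE *.
have msqrt (f : T -> R) : measurable_fun setT f ->
    measurable_fun setT (fun x => Num.sqrt (f x)).
  by move=> mf; exact: (measurableT_comp (@measurable_sqrt R) mf).
have mph : measurable_fun setT (fun x => ((Num.sqrt (p x) - Num.sqrt (h x)) ^+ 2)%:E).
  by apply/measurable_EFinP/measurable_funX/measurable_funB; exact: msqrt.
move=> hell; have {}hell :
    \int[r]_x `|((Num.sqrt (p x) - Num.sqrt (h x)) ^+ 2)%:E| = 0.
  under eq_integral do rewrite gee0_abs ?lee_fin ?sqr_ge0//.
  apply/eqP; rewrite eq_le hell_ge0 andbT (le_trans hell)//.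
  by rewrite sube_le0 (le_trans eP).
have ph := (ae_eq_integral_abs _ measurableT mph).1 hell.
rewrite pE// PhatE//; apply: ae_eq_integral => //.
- exact/measurable_EFinP/measurable_funTS.
- exact/measurable_EFinP/measurable_funTS.
apply: filterS ph => x /(_ I)[/eqP]; rewrite sqrf_eq0 subr_eq0 => /eqP sph _.
by rewrite -(sqr_sqrtr (p0 x)) sph sqr_sqrtr.
Qed.

End optimality.

(** * The marginal of the reference measure is sigma-finite *)

Lemma sigma_finite_measureP d (T : measurableType d) (R : realType)
    (p : {measure set T -> \bar R}) : sigma_finite setT p ->
  exists q : {sigma_finite_measure set T -> \bar R}, p = q :> (set T -> \bar R).
Proof.
move=> sp; pose i := isSigmaFinite.Build _ _ _ p sp.
pose j := isSFinite.Build _ _ _ p (sfinite_measure_sigma_finite sp).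
by exists (HB.pack_for {sigma_finite_measure set T -> \bar R} (Measure.sort p) i j).
Qed.

Lemma sfinite_measureP d (T : measurableType d) (R : realType)
    (p : {measure set T -> \bar R}) : sfinite_measure p ->
  exists q : {sfinite_measure set T -> \bar R}, p = q :> (set T -> \bar R).
Proof.
move=> sp; pose i := isSFinite.Build _ _ _ p sp.
by exists (HB.pack_for {sfinite_measure set T -> \bar R} (Measure.sort p) i).
Qed.

(** Unlike sigma-finiteness, s-finiteness survives taking images: the finite pieces are pushed
    forward one by one. *)
Lemma sfinite_image d d' (T : measurableType d) (T' : measurableType d')
    (R : realType) (p : {sfinite_measure set T -> \bar R})
    (q : {measure set T' -> \bar R}) (X : T -> T') :
  measurable_fun setT X -> measure_eq (pushforward p X) q -> sfinite_measure q.
Proof.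
move=> mX pq; have [s sfin sE] := @s_finite _ _ _ p.
have /choice[t tE] n := image_measure (s n) mX.
exists t => [n E mE|E mE].
  rewrite -tE /pushforward; apply: sfin.
  by rewrite -[X in measurable X]setTI; exact: mX.
rewrite -pq// /pushforward sE; last by rewrite -[X in measurable X]setTI; exact: mX.
by apply: eq_eseriesr => n _; rewrite -tE.
Qed.

Section sfinite_product.
Context d d' (T : measurableType d) (T' : measurableType d') (R : realType).
Variables (p : {measure set T -> \bar R}) (q : {sfinite_measure set T' -> \bar R}).

(** Hypothesis (ii) involves [m \x m] before [m] is known to be sigma-finite. This and the next two
    lemmas treat a product whose second factor is only s-finite, by summing over finite pieces. *)
Lemma sfinite_measurable_xsection (E : set (T * T')) : measurable E ->
  measurable_fun setT (q \o xsection E).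
Proof.
move=> mE; rewrite (_ : q \o _ =
    fun x => \sum_(n <oo) sfinite_measure_seq q n (xsection E x)).
  apply: ge0_emeasurable_sum => // n _.
  exact: (measurable_fun_xsection (sfinite_measure_seq q n) mE).
by apply/funext => x /=; rewrite sfinite_measure_seqP//; exact: measurable_xsection.
Qed.

Lemma sfinite_product_measure :
  exists pq : {measure set (T * T')%type -> \bar R},
    p \x q = pq :> (set (T * T')%type -> \bar R).
Proof.
have pq0 : (p \x q) set0 = 0.
  by rewrite [LHS]integral0_eq// => x _ /=; rewrite xsection0.
have pq_ge0 E : 0 <= (p \x q) E by apply: integral_ge0.
have pqsa : semi_sigma_additive (p \x q).
  move=> F mF tF mUF.
  rewrite [X in _ --> X](_ : _ = \sum_(n <oo) (p \x q) (F n)).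
    by apply: is_cvg_nneseries => n _ _; exact: pq_ge0.
  rewrite -integral_nneseries//; last by move=> n; exact: sfinite_measurable_xsection.
  apply: eq_integral => x _; rewrite /= xsection_bigcup.
  apply/esym/cvg_lim => //; apply: measure_sigma_additive.
    by move=> n; exact: measurable_xsection.
  exact: trivIset_xsection.
pose i := isMeasure.Build _ _ _ (p \x q) pq0 pq_ge0 pqsa.
by exists (HB.pack_for {measure set (T * T')%type -> \bar R} (p \x q) i).
Qed.

Lemma sfinite_product_rectangle (E : set T) (E' : set T') :
  measurable E -> measurable E' -> (p \x q) (E `*` E') = p E * q E'.
Proof.
move=> mE mE'; rewrite /product_measure1.
rewrite (eq_integral (fun x => (\1_E x)%:E * q E')); last first.
  move=> x _; rewrite indicE /=; have [xE|xE] := boolP (x \in E).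
    by rewrite in_xsectionX// mul1e.
  by rewrite notin_xsectionX// mul0e.
rewrite ge0_integralZr//; first by rewrite integral_indic// setIT.
by apply/measurable_EFinP; exact: measurable_indic.
Qed.

End sfinite_product.

(** On [K n], where [A] and [B] are at most [n], both weights are at least [c = expR (- 2 n)].
    Chaining (ii) and (iii) bounds [c ^ 2 * m (K n) ^ 2] by a finite integral. *)
Lemma sigma_finite_of_product d (T : measurableType d) (R : realType)
    (m : {measure set T -> \bar R}) (r : {measure set (T * T)%type -> \bar R})
    (A B : T -> R) :
  sfinite_measure m -> measurable_fun setT A -> measurable_fun setT B ->
  (forall E, measurable E ->
    with_density (fun z => expR (- A z.1 - A z.2)) (m \x m) E <= r E) ->
  \int[r]_z (expR (- B z.1 - B z.2))%:E < +oo ->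
  sigma_finite setT m.
Proof.
move=> sm mA mB mr rB.
have [m' m'E] := sfinite_measureP sm.
have [q qE] := sfinite_product_measure m m'.
have rect E E' : measurable E -> measurable E' -> q (E `*` E') = m E * m E'.
  by move=> mE mE'; rewrite -qE m'E sfinite_product_rectangle.
rewrite -m'E in qE.
pose K n := [set x | (A x <= n%:R)%R] `&` [set x | (B x <= n%:R)%R].
have mK n : measurable (K n).
  by apply: measurableI; rewrite -[X in measurable X]setTI; exact: measurable_fun_le.
exists K.
  apply/esym; rewrite -subTset => x _.
  pose a := Num.max (A x) (B x); exists (Num.truncn a).+1 => //=.
  have := ltW (truncnS_gt a); rewrite /a ge_max => /andP[? ?]; exact: conj.
move=> n; split => //.
have mKK : measurable (K n `*` K n) by exact: measurableX.
pose c := expR (- n%:R - n%:R) : R.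
have c0 : (0 < c)%R by exact: expR_gt0.
have expB (C : T -> R) x y : (C x <= n%:R)%R -> (C y <= n%:R)%R ->
  (c <= expR (- C x - C y))%R by move=> ? ?; rewrite ler_expR lerB// lerN2.
have mexp (C : T -> R) : measurable_fun setT C ->
    measurable_fun setT (fun z : (T * T)%type => (expR (- C z.1 - C z.2))%:E).
  move=> mC; apply/measurable_EFinP/measurableT_comp => //.
  by apply: measurable_funB; [apply: measurableT_comp => //|]; exact: measurableT_comp.
have cK : c%:E * (c%:E * (m (K n) * m (K n))) < +oo.
  apply: le_lt_trans rB; rewrite -rect//.
  apply: (@le_trans _ _ (c%:E * r (K n `*` K n))).
    rewrite lee_wpmul2l ?lee_fin ?expR_ge0//.
    apply: le_trans (mr _ mKK); rewrite /with_density qE -integral_cst//.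
    apply: ge0_le_integral => //.
    - by move=> z _; rewrite lee_fin ltW.
    - by apply: measurable_funTS; exact: mexp.
    - by move=> z [[? _] [? _]]; rewrite lee_fin expB.
  rewrite -integral_cst//.
  apply: (@le_trans _ _ (\int[r]_(z in K n `*` K n) (expR (- B z.1 - B z.2))%:E)).
    apply: ge0_le_integral => //.
    - by move=> z _; rewrite lee_fin ltW.
    - by apply: measurable_funTS; exact: mexp.
    - by move=> z [[_ ?] [_ ?]]; rewrite lee_fin expB.
  by apply: ge0_subset_integral => //; exact: mexp.
have := measure_ge0 m (K n); move: cK.
case: (m (K n)) => [s _ _|+ _|//]; first exact: ltry.
by rewrite mulyy gt0_muley ?lte_fin// gt0_muley ?lte_fin.
Qed.

(** * Potentials of the static problem *)

(** Equality holds for [x > 0]; the inequality form also covers points where a density vanishes. *)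
Lemma exp_lnM_le1 (R : realType) (x : R) : (0 <= x -> expR (- ln x) * x <= 1)%R.
Proof.
rewrite le_eqVlt => /predU1P[<-|x0]; first by rewrite mulr0.
by rewrite expRN lnK ?posrE// mulVf// gt_eqF.
Qed.

(** Tonelli's theorem, with the two densities introduced one variable at a time. *)
Lemma ge0_integral_product_density d0 d1 (T0 : measurableType d0)
    (T1 : measurableType d1) (R : realType)
    (m0 : {sigma_finite_measure set T0 -> \bar R})
    (m1 : {sigma_finite_measure set T1 -> \bar R})
    (p0 : {sigma_finite_measure set T0 -> \bar R})
    (p1 : {sigma_finite_measure set T1 -> \bar R})
    (h0 : T0 -> R) (h1 : T1 -> R) (F : (T0 * T1)%type -> \bar R) :
  is_density p0 m0 h0 -> is_density p1 m1 h1 ->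
  measurable_fun setT F -> (forall z, 0 <= F z) ->
  \int[p0 \x p1]_z F z = \int[m0 \x m1]_z (F z * (h0 z.1 * h1 z.2)%:E).
Proof.
move=> [mh0 h0_ge0 p0E] [mh1 h1_ge0 p1E] mF F0.
have mh0' : measurable_fun setT (fun z : (T0 * T1)%type => (h0 z.1)%:E).
  exact/measurable_EFinP/measurableT_comp.
have mh1' : measurable_fun setT (fun z : (T0 * T1)%type => (h1 z.2)%:E).
  exact/measurable_EFinP/measurableT_comp.
have mh1E : measurable_fun setT (EFin \o h1) by exact/measurable_EFinP.
have mF1 : measurable_fun setT (fun z : (T0 * T1)%type => F z * (h1 z.2)%:E).
  exact: emeasurable_funM.
have F1_ge0 z : 0 <= F z * (h1 z.2)%:E by rewrite mule_ge0// lee_fin.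
rewrite fubini_tonelli1// fubini_tonelli1; last 2 first.
- apply: emeasurable_funM => //; under eq_fun do rewrite EFinM.
  exact: emeasurable_funM.
- by move=> z; rewrite mule_ge0// lee_fin mulr_ge0.
transitivity (\int[p0]_x \int[m1]_y (F (x, y) * (h1 y)%:E)).
  apply: eq_integral => x _; apply: (ge0_integral_density (e := EFin \o h1)) => //.
  by apply: (measurableT_comp mF); exact: measurable_pair1.
rewrite (ge0_integral_density (p := m0) (e := EFin \o h0))//; last 3 first.
- exact/measurable_EFinP.
- exact: (@measurable_fun_fubini_tonelli_F _ _ _ _ _ m1 _ mF1 F1_ge0).
- by move=> x; apply: integral_ge0 => y _; exact: (F1_ge0 (x, y)).
apply: eq_integral => x _ /=; rewrite /fubini_F muleC.
have mFx : measurable_fun setT (fun y => F (x, y) * (h1 y)%:E).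
  by apply: (measurableT_comp mF1); exact: measurable_pair1.
rewrite -ge0_integralZl ?lee_fin//.
by apply: eq_integral => y _; rewrite muleCA -EFinM.
Qed.

Section product_lower_bound.
Context d (T : measurableType d) (R : realType).
Variables (m : {sigma_finite_measure set T -> \bar R})
  (M : {measure set (T * T)%type -> \bar R})
  (nu : {measure set (T * T)%type -> \bar R}).
Variables (A B : T -> R) (mu0 mu1 : probability T R) (h0 h1 : T -> R).
Hypotheses (mA : measurable_fun setT A) (mB : measurable_fun setT B).
Hypothesis M_ge : forall E, measurable E ->
  with_density (fun z => expR (- A z.1 - A z.2)) (m \x m) E <= M E.
Hypothesis nuE : measure_eq nu (with_density (fun z => expR (- B z.1 - B z.2)) M).
Hypotheses (mu0h : is_density mu0 m h0) (mu1h : is_density mu1 m h1).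

Let mexp (C : T -> R) : measurable_fun setT C ->
  measurable_fun setT (fun z : (T * T)%type => (expR (- C z.1 - C z.2))%:E).
Proof.
move=> mC; apply/measurable_EFinP/measurableT_comp => //.
by apply: measurable_funB; [apply: measurableT_comp => //|]; exact: measurableT_comp.
Qed.

(** This establishes [nu_ge]. Passing from [mu0 \x mu1] to [m \x m] brings in [h0] and [h1], which
    the terms [- ln h0] and [- ln h1] of the exponent compensate by [exp_lnM_le1]; the terms in [A]
    lead to [M] by (ii), and those in [B] lead from [M] to [nu]. *)
Lemma product_lower_bound (F : (T * T)%type -> \bar R) :
  measurable_fun setT F -> (forall z, 0 <= F z) ->
  \int[mu0 \x mu1]_z (F z *
    (expR (- ((A z.1 + B z.1 + ln (h0 z.1)) + (A z.2 + B z.2 + ln (h1 z.2)))))%:E)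
  <= \int[nu]_z F z.
Proof.
move=> mF F0; have [mh0 h0_ge0 _] := mu0h; have [mh1 h1_ge0 _] := mu1h.
have mz1 (C : T -> R) : measurable_fun setT C -> measurable_fun setT (fun z : (T * T)%type => C z.1).
  by move=> mC; exact: measurableT_comp.
have mz2 (C : T -> R) : measurable_fun setT C -> measurable_fun setT (fun z : (T * T)%type => C z.2).
  by move=> mC; exact: measurableT_comp.
have mG (C : T -> R) : measurable_fun setT C -> measurable_fun setT (fun x => A x + B x + ln (C x))%R.
  move=> mC; apply: measurable_funD; first exact: measurable_funD.
  exact: measurableT_comp.
have mH : measurable_fun setT (fun z : (T * T)%type => F z *
    (expR (- ((A z.1 + B z.1 + ln (h0 z.1)) + (A z.2 + B z.2 + ln (h1 z.2)))))%:E).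
  apply: emeasurable_funM => //; apply/measurable_EFinP/measurableT_comp => //.
  apply: measurableT_comp => //; apply: measurable_funD.
    by apply: (mz1 (fun x => A x + B x + ln (h0 x))%R); exact: mG.
  by apply: (mz2 (fun x => A x + B x + ln (h1 x))%R); exact: mG.
have FB0 z : 0 <= F z * (expR (- B z.1 - B z.2))%:E by rewrite mule_ge0// lee_fin expR_ge0.
have mFB : measurable_fun setT (fun z => F z * (expR (- B z.1 - B z.2))%:E).
  by apply: emeasurable_funM => //; exact: mexp.
rewrite [leRHS](ge0_integral_density (p := M) (e := fun z => (expR (- B z.1 - B z.2))%:E))//; last exact: mexp.
have [q qE] := @measure_of_density _ _ R (fun z => (expR (- A z.1 - A z.2))%:E)
  (m \x m) (mexp mA) (fun z => expR_ge0 _).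
apply: (@le_trans _ _ (\int[q]_z (F z * (expR (- B z.1 - B z.2))%:E))); last first.
  by apply: ge0_le_measure_integral => // E mE; rewrite -qE; exact: M_ge.
rewrite (ge0_integral_density (p := m \x m) (e := fun z => (expR (- A z.1 - A z.2))%:E))//; last 2 first.
- exact: mexp.
- by move=> E mE; rewrite -qE.
rewrite (ge0_integral_product_density mu0h mu1h)//; last first.
  by move=> z; rewrite mule_ge0// lee_fin expR_ge0.
apply: ge0_le_integral => //.
- by move=> z _; rewrite mule_ge0// ?mule_ge0// lee_fin ?expR_ge0// mulr_ge0.
- apply: emeasurable_funM => //; apply/measurable_EFinP/measurable_funM.
    exact: mz1.
  exact: mz2.
- by apply: emeasurable_funM => //; exact: mexp.
move=> z _; rewrite -!muleA lee_wpmul2l// -!EFinM lee_fin.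
rewrite (_ : _ * (h0 _ * _) = expR (- B z.1 - B z.2) * expR (- A z.1 - A z.2) *
  ((expR (- ln (h0 z.1)) * h0 z.1) * (expR (- ln (h1 z.2)) * h1 z.2)))%R; last first.
  rewrite (_ : - _ = (- B z.1 - B z.2) + (- A z.1 - A z.2) + (- ln (h0 z.1)) + (- ln (h1 z.2)))%R; last by ring.
  by rewrite !expRD; ring.
rewrite ler_piMr// ?mulr_ge0 ?expR_ge0// mulr_ile1 ?exp_lnM_le1//.
  by rewrite mulr_ge0 ?expR_ge0.
by rewrite mulr_ge0 ?expR_ge0.
Qed.

End product_lower_bound.

Lemma finite_measureP d (T : measurableType d) (R : realType)
    (p : {measure set T -> \bar R}) : p setT < +oo ->
  exists q : {finite_measure set T -> \bar R}, p = q :> (set T -> \bar R).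
Proof.
move=> poo.
have fp : fin_num_fun p.
  move=> E mE; rewrite ge0_fin_numE// (le_lt_trans _ poo)// le_measure ?inE//.
have sp : sigma_finite setT p.
  by apply: fin_num_fun_sigma_finite => //; rewrite measure0.
pose i := isSigmaFinite.Build _ _ _ p sp.
pose j := isSFinite.Build _ _ _ p (sfinite_measure_sigma_finite sp).
pose l := isFinite.Build _ _ _ p fp.
by exists (HB.pack_for {finite_measure set T -> \bar R} (Measure.sort p) i j l).
Qed.

Lemma probabilityP d (T : measurableType d) (R : realType)
    (p : {measure set T -> \bar R}) : p setT = 1 ->
  exists q : probability T R, p = q :> (set T -> \bar R).
Proof.
move=> p1; have [q qE] : exists q : {finite_measure set T -> \bar R}, p = q :> (set T -> \bar R).
  by apply: finite_measureP; rewrite p1 ltry.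
rewrite qE in p1 *.
pose i := isProbability.Build _ _ _ q p1.
have q1 : q setT <= 1 by rewrite p1.
pose j := isSubProbability.Build _ _ _ q q1.
by exists (HB.pack_for (probability T R) (FiniteMeasure.sort q) j i).
Qed.

Lemma ae_eq_integrable d (T : measurableType d) (R : realType)
    (p : {measure set T -> \bar R}) (f g : T -> \bar R) :
  measurable_fun setT f -> {ae p, forall x, f x = g x} ->
  p.-integrable setT g -> p.-integrable setT f.
Proof.
move=> mf fg /integrableP[mg goo]; apply/integrableP; split => //.
rewrite (ae_eq_integral (abse \o g))//.
- exact: measurableT_comp.
- exact: measurableT_comp.
- by apply: filterS fg => x /= ->.
Qed.

Section static_potentials.
Context d (T : measurableType d) (R : realType).
Variables (m : {sigma_finite_measure set T -> \bar R})
  (M : {measure set (T * T)%type -> \bar R}).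
Variables (A B : T -> R) (mu0 mu1 : probability T R).
Hypotheses (mA : measurable_fun setT A) (A_ge0 : forall x, (0 <= A x)%R).
Hypotheses (mB : measurable_fun setT B) (B_ge0 : forall x, (0 <= B x)%R).
Hypothesis M_ge : forall E, measurable E ->
  with_density (fun z => expR (- A z.1 - A z.2)) (m \x m) E <= M E.
Hypothesis MB : \int[M]_z (expR (- B z.1 - B z.2))%:E < +oo.
Hypotheses (ent0 : entropy mu0 m < +oo) (ent1 : entropy mu1 m < +oo).
Hypotheses (AB0 : \int[mu0]_x (A x + B x)%:E < +oo)
  (AB1 : \int[mu1]_x (A x + B x)%:E < +oo).

Let integrable_AB (p : probability T R) : \int[p]_x (A x + B x)%:E < +oo ->
  p.-integrable setT (fun x => (A x + B x)%:E) /\ p.-integrable setT (EFin \o B).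
Proof.
move=> ABoo; have mAB : measurable_fun setT (fun x => (A x + B x)%:E).
  by apply/measurable_EFinP; exact: measurable_funD.
have iAB : p.-integrable setT (fun x => (A x + B x)%:E).
  apply/integrableP; split => //.
  by under eq_integral do rewrite gee0_abs ?lee_fin ?addr_ge0//.
split => //; apply: le_integrable iAB => //; first exact/measurable_EFinP.
by move=> x _ /=; rewrite lee_fin !ger0_norm ?addr_ge0// lerDr.
Qed.

Let integrable_G (p : probability T R) : entropy p m < +oo ->
  \int[p]_x (A x + B x)%:E < +oo ->
  p.-integrable setT (EFin \o (fun x => A x + B x + ln (rn_deriv p m x))%R).
Proof.
move=> /entropy_lty[_ iln _] /integrable_AB[iAB _].
rewrite /comp; under eq_fun do rewrite EFinD.
exact: integrableD.
Qed.

Let w (z : (T * T)%type) := expR (- B z.1 - B z.2).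

Let mw : measurable_fun setT w.
Proof.
apply: measurableT_comp => //.
by apply: measurable_funB; [apply: measurableT_comp => //|]; exact: measurableT_comp.
Qed.

(** The dual problem is solved for the finite measure [nu = w M], and the weight [w] is then
    absorbed: [B] is subtracted from the potentials, [f] and [g] are multiplied by [expR (- B)], and
    the limit value drops by the integrals of [B]. The resulting potentials are integrable, though
    no longer bounded in general. *)
Lemma static_potentials : exists (f g : T -> R) (a b : (T -> R)^nat) (L : R),
  [/\ [/\ measurable_fun setT f, measurable_fun setT g,
          (forall x, 0 <= f x)%R & (forall y, 0 <= g y)%R],
      (forall n, mu0.-integrable setT (EFin \o a n)) /\
        (forall n, mu1.-integrable setT (EFin \o b n)),
      [/\ (forall n, M.-integrable setT (fun z => (expR (a n z.1 + b n z.2))%:E)),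
          (\int[M]_z expR (a n z.1 + b n z.2))%R @[n --> \oo] --> (1 : R)%R,
          {ae M, forall z,
            expR (a n z.1 + b n z.2) @[n --> \oo] --> (f z.1 * g z.2)%R} &
          (\int[mu0]_x a n x + \int[mu1]_y b n y)%R @[n --> \oo] --> L],
      (forall E, measurable E ->
        \int[M]_(z in fst @^-1` E) (f z.1 * g z.2)%:E = mu0 E) /\
      (forall E, measurable E ->
        \int[M]_(z in snd @^-1` E) (f z.1 * g z.2)%:E = mu1 E) &
      exists p : {measure set (T * T)%type -> \bar R},
        [/\ measure_eq p (with_density (fun z => f z.1 * g z.2)%R M),
            p.-integrable setT (fun z => (ln (f z.1 * g z.2))%:E) &
            \int[p]_z (ln (f z.1 * g z.2))%:E <= L%:E]].
Proof.
have mwE : measurable_fun setT (EFin \o w) by exact/measurable_EFinP.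
have w0 z : (0 < w z)%R by exact: expR_gt0.
have wE0 z : 0 <= (w z)%:E by rewrite lee_fin ltW.
have [nu' nu'E] := measure_of_density M mwE wE0.
have nu'oo : nu' setT < +oo by rewrite -nu'E.
have [nu nuE] := finite_measureP nu'oo.
have {nu' nu'E nu'oo nuE}nuE E : measurable E -> nu E = \int[M]_(z in E) (w z)%:E.
  by move=> mE; rewrite -nuE -nu'E.
have nuint F : measurable_fun setT F -> (forall z, 0 <= F z) ->
    \int[nu]_z F z = \int[M]_z (F z * (w z)%:E).
  by move=> mF F0; exact: ge0_integral_density mwE wE0 nuE mF F0.
have [den0 _ _] := entropy_lty ent0; have [den1 _ _] := entropy_lty ent1.
have [f [g [phi [psi [L [[mf mg f0 g0] [bphi bpsi] [vk mass cL] [marg0 marg1] [ik kL]]]]]]] :=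
  schrodinger_potentials (integrable_G ent0 AB0) (integrable_G ent1 AB1)
    (product_lower_bound mA mB M_ge nuE den0 den1).
have [_ iB0] := integrable_AB AB0; have [_ iB1] := integrable_AB AB1.
have mk : measurable_fun setT (fun z : (T * T)%type => f z.1 * g z.2)%R.
  by apply: measurable_funM; exact: measurableT_comp.
pose k (z : (T * T)%type) := (f z.1 * g z.2)%R.
have k0' z : (0 <= k z)%R by rewrite mulr_ge0.
have mkE : measurable_fun setT (EFin \o k) by exact/measurable_EFinP.
have k0 z : 0 <= (EFin \o k) z by rewrite lee_fin.
have nukE E : measurable E ->
    \int[nu]_(z in E) (k z)%:E = \int[M]_(z in E) (k z * w z)%:E.
  move=> mE; rewrite integral_mkcond nuint; first last.
  - by move=> z; rewrite patchE; case: ifP => // _; rewrite lee_fin k0'.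
  - by apply/(measurable_restrictT _ mE); exact: measurable_funTS.
  rewrite [RHS]integral_mkcond; apply: eq_integral => z _.
  by rewrite !patchE; case: ifP => // _; rewrite mul0e.
pose F x := (f x * expR (- B x))%R; pose G x := (g x * expR (- B x))%R.
have FGE z : (F z.1 * G z.2 = f z.1 * g z.2 * w z)%R.
  by rewrite /F /G /w expRD; ring.
have mE (C : T -> R) : measurable_fun setT C -> measurable_fun setT (fun x => C x * expR (- B x))%R.
  move=> mC; apply: measurable_funM => //.
  by apply: measurableT_comp => //; exact: measurableT_comp.
pose L' := (L - (\int[mu0]_x B x + \int[mu1]_x B x))%R.
pose a n x := (phi n x - B x)%R; pose b n x := (psi n x - B x)%R.
have abE n z : expR (a n z.1 + b n z.2) = (expR (phi n z.1 + psi n z.2) * w z)%R.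
  by rewrite -expRD; congr expR; rewrite /a /b; ring.
have iphi n := bounded_measurable_integrable mu0 (bphi n).
have ipsi n := bounded_measurable_integrable mu1 (bpsi n).
exists F, G, a, b, L'; split.
- split; [exact: mE|exact: mE| |] => x; by rewrite mulr_ge0 ?expR_ge0.
- by split => n; [exact: (integrableB measurableT (iphi n) iB0)|exact: (integrableB measurableT (ipsi n) iB1)].
- have ie n := integrable_exp_pair nu (bphi n) (bpsi n).
  have me n : measurable_fun setT (fun z : (T * T)%type => expR (phi n z.1 + psi n z.2)).
    by apply/measurable_EFinP; exact: measurable_int (ie n).
  have w0' z : (0 <= w z)%R by exact: ltW.
  split.
  + move=> n; under eq_fun do rewrite abE.
    exact: (integrable_density mw w0' nuE (me n)).2 (ie n).
  + rewrite (_ : (fun n => _) = (fun n => \int[nu]_z expR (phi n z.1 + psi n z.2))%R)//.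
    apply/funext => n; rewrite /Rintegral (integral_density mw w0' nuE (me n)).
    by congr fine; apply: eq_integral => z _; rewrite abE.
  (* As [w] is positive, [nu]-null sets are [M]-null, and the almost everywhere convergence carries
     over to [M]. *)
  + have Mnu : M `<< nu.
      apply/null_content_dominatesP => E mE' nuE0.
      apply: (measure0_integral0 mwE) => //.
      by rewrite -nuE.
    apply: filterS (ae_dominates Mnu vk) => z vkz; rewrite FGE.
    under eq_fun do rewrite abE.
    by apply: cvgM => //; exact: cvg_cst.
  + rewrite (_ : (fun n => _) = (fun n => \int[mu0]_x phi n x + \int[mu1]_x psi n x -
      (\int[mu0]_x B x + \int[mu1]_x B x))%R); first by apply: cvgB => //; exact: cvg_cst.
    by apply/funext => n; rewrite !RintegralB//; ring.
- by split => E mE'; under eq_integral do rewrite FGE; rewrite -nukE ?marg0 ?marg1//;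
    rewrite -[X in measurable X]setTI; [exact: measurable_fst|exact: measurable_snd].
have [p pE] := measure_of_density nu mkE (fun z => k0 z).
have {}pE E : measurable E -> p E = \int[nu]_(z in E) (k z)%:E by rewrite -pE.
have mlnk : measurable_fun setT (fun z => ln (k z)) by exact: measurableT_comp.
have ilnk : p.-integrable setT (fun z => (ln (k z))%:E).
  exact: (integrable_density mk k0' pE mlnk).1 ik.
have lnkE := integral_density mk k0' pE mlnk.
have p_fst : measure_eq (pushforward p fst) mu0.
  move=> E mE'; rewrite /pushforward pE ?marg0//.
  by rewrite -[X in measurable X]setTI; exact: measurable_fst.
have p_snd : measure_eq (pushforward p snd) mu1.
  move=> E mE'; rewrite /pushforward pE ?marg1//.
  by rewrite -[X in measurable X]setTI; exact: measurable_snd.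
have [iBB BBE] := integral_sum_marginals measurable_fst measurable_snd p_fst p_snd iB0 iB1.
(* The logarithm of [k * w] splits only where [k > 0], and the measure [p] with density [k] gives no
   mass to the rest. *)
have kpos : {ae p, forall z, (0 < k z)%R}.
  exists [set z | (k z <= 0)%R]; split.
  - by rewrite -[X in measurable X]setTI; exact: measurable_fun_le.
  - rewrite pE; last by rewrite -[X in measurable X]setTI; exact: measurable_fun_le.
    apply: integral0_eq => z /= kz; congr EFin; apply/eqP.
    by rewrite eq_le kz k0'.
  - by move=> z /= /negP; rewrite -leNgt.
have lnFG : {ae p, forall z, (ln (F z.1 * G z.2))%:E = (ln (k z))%:E - (B z.1 + B z.2)%:E}.
  apply: filterS kpos => z kz; rewrite FGE lnM ?posrE// /w expRK -EFinB.
  by congr EFin; ring.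
have mlnFG : measurable_fun setT (fun z : (T * T)%type => (ln (F z.1 * G z.2))%:E).
  apply/measurable_EFinP/measurableT_comp => //.
  by under eq_fun do rewrite FGE; exact: measurable_funM.
have idiff := integrableB measurableT ilnk iBB.
exists p; split.
- move=> E mE'; rewrite pE// nukE// /with_density.
  by apply: eq_integral => z _; rewrite FGE.
- exact: ae_eq_integrable mlnFG lnFG idiff.
rewrite (ae_eq_integral (fun z => (ln (k z))%:E - (B z.1 + B z.2)%:E))//; last 2 first.
- exact: measurable_int idiff.
- by apply: filterS lnFG.
rewrite integralB// lnkE BBE /L' EFinB leeB//.
by rewrite -[leLHS]fineK ?lee_fin//; exact: integrable_fin_num.
Qed.

End static_potentials.

(** * Solutions on a general space *)

Lemma ae_marginal d d' (W : measurableType d) (T : measurableType d')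
    (R : realType) (q : {measure set W -> \bar R}) (p : {measure set T -> \bar R})
    (X : W -> T) (P : set T) :
  measurable_fun setT X -> measure_eq (pushforward q X) p ->
  {ae p, forall z, P z} -> {ae q, forall w, P (X w)}.
Proof.
move=> mX qp [N [mN N0 PN]]; exists (X @^-1` N); split.
- by rewrite -[X in measurable X]setTI; exact: mX.
- by rewrite -N0 -qp.
- by move=> w h; exact: PN.
Qed.

Section endpoint_solution.
Context d d' (W : measurableType d) (T : measurableType d') (R : realType).
Variables (r : {sigma_finite_measure set W -> \bar R}) (X0 X1 : W -> T).
Hypotheses (mX0 : measurable_fun setT X0) (mX1 : measurable_fun setT X1).
Variable M : {measure set (T * T)%type -> \bar R}.
Hypothesis rM : measure_eq (pushforward r (fun w => (X0 w, X1 w))) M.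
Variables (mu0 mu1 : probability T R) (f g : T -> R) (a b : (T -> R)^nat) (L : R).
Hypotheses (mf : measurable_fun setT f) (mg : measurable_fun setT g).
Hypotheses (f0 : forall x, (0 <= f x)%R) (g0 : forall y, (0 <= g y)%R).
Hypotheses (ia : forall n, mu0.-integrable setT (EFin \o a n))
  (ib : forall n, mu1.-integrable setT (EFin \o b n)).
Hypothesis iexp : forall n,
  M.-integrable setT (fun z => (expR (a n z.1 + b n z.2))%:E).
Hypothesis mass :
  (\int[M]_z expR (a n z.1 + b n z.2))%R @[n --> \oo] --> (1 : R)%R.
Hypothesis ab_cvg : {ae M, forall z,
  expR (a n z.1 + b n z.2) @[n --> \oo] --> (f z.1 * g z.2)%R}.
Hypothesis cL : (\int[mu0]_x a n x + \int[mu1]_y b n y)%R @[n --> \oo] --> L.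
Hypotheses
  (marg0 : forall E, measurable E ->
    \int[M]_(z in fst @^-1` E) (f z.1 * g z.2)%:E = mu0 E)
  (marg1 : forall E, measurable E ->
    \int[M]_(z in snd @^-1` E) (f z.1 * g z.2)%:E = mu1 E).
Variable p : {measure set (T * T)%type -> \bar R}.
Hypotheses (pE : measure_eq p (with_density (fun z => f z.1 * g z.2)%R M))
  (ilnp : p.-integrable setT (fun z => (ln (f z.1 * g z.2))%:E))
  (lnpL : \int[p]_z (ln (f z.1 * g z.2))%:E <= L%:E).

Let X w := (X0 w, X1 w).

Let mX : measurable_fun setT X.
Proof. exact: measurable_fun_pair. Qed.

Let h w := (f (X0 w) * g (X1 w))%R.

Let h0 w : (0 <= h w)%R. Proof. exact: mulr_ge0. Qed.

Let mh : measurable_fun setT h.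
Proof. by apply: measurable_funM; exact: measurableT_comp. Qed.

Let mfg : measurable_fun setT (fun z : (T * T)%type => (f z.1 * g z.2)%:E).
Proof. by apply/measurable_EFinP/measurable_funM; exact: measurableT_comp. Qed.

Lemma integral_endpoint_density (E : set (T * T)%type) : measurable E ->
  \int[r]_(w in X @^-1` E) (h w)%:E = \int[M]_(z in E) (f z.1 * g z.2)%:E.
Proof.
move=> mE; rewrite integral_mkcond [RHS]integral_mkcond.
rewrite -(ge0_integral_marginal mX rM).
- apply: eq_integral => w _; rewrite !patchE.
  by rewrite (_ : (w \in X @^-1` E) = (X w \in E)).
- by apply/(measurable_restrictT _ mE); exact: measurable_funTS.
- by move=> z; rewrite patchE; case: ifP => // _; rewrite lee_fin mulr_ge0.
Qed.

(** Serves twice: on path space with the two endpoint maps, and on pairs with the two projections.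
    The functions [a n (X0 w) + b n (X1 w)] depend on the endpoints alone, so all competitors give
    them the same integral and [density_unique_solution] applies. *)
Lemma endpoint_solution : exists Phat : probability W R,
  unique_solution r [set P | measure_eq (pushforward P X0) mu0 /\
                             measure_eq (pushforward P X1) mu1] Phat /\
  measure_eq Phat (with_density h r).
Proof.
have mhE : measurable_fun setT (EFin \o h) by exact/measurable_EFinP.
have [P' P'E] := measure_of_density r mhE (fun w => h0 w).
have P'T : P' setT = 1.
  rewrite -P'E -(preimage_setT X) integral_endpoint_density//.
  by rewrite -(@probability_setT _ _ _ mu0) -marg0.
have [Phat PhatE'] := probabilityP P'T.
have PhatE : measure_eq Phat (with_density h r).
  by move=> E mE; rewrite -PhatE' -P'E.
have PhatX E : measurable E -> Phat (X @^-1` E) = \int[M]_(z in E) (f z.1 * g z.2)%:E.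
  move=> mE; rewrite PhatE ?integral_endpoint_density//.
    exact: integral_endpoint_density.
  by rewrite -[X in measurable X]setTI; exact: mX.
exists Phat; split => //.
have rexp n := integral_marginal mX rM (iexp n).
have Phatp : measure_eq (pushforward Phat X) p.
  by move=> E mE; rewrite /pushforward PhatX// pE.
have [ilnh lnhE] := integral_marginal mX Phatp ilnp.
apply: (@density_unique_solution _ _ _ _ _ _ h
  (fun n w => a n (X0 w) + b n (X1 w))%R
  (fun n => \int[mu0]_x a n x + \int[mu1]_y b n y)%R L) => //.
- split => E mE.
  + by rewrite -marg0// -PhatX// -[X in measurable X]setTI; exact: measurable_fst.
  + by rewrite -marg1// -PhatX// -[X in measurable X]setTI; exact: measurable_snd.
- move=> n; apply: measurable_funD; apply: measurableT_comp => //.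
    by apply/measurable_EFinP; exact: measurable_int (ia n).
  by apply/measurable_EFinP; exact: measurable_int (ib n).
- move=> n P [P0 P1].
  exact: (integral_sum_marginals mX0 mX1 P0 P1 (ia n) (ib n)).
- by move=> n; exact: (rexp n).1.
- rewrite (_ : (fun n => _) = fun n => (\int[M]_z expR (a n z.1 + b n z.2))%R)//.
  by apply/funext => n; rewrite /Rintegral -(rexp n).2.
- exact: (ae_marginal mX rM ab_cvg).
- by rewrite lnhE.
Qed.

End endpoint_solution.

(** * Conditional expectations and the Schrödinger system *)

Section conditional_expectation.
Context d d' (W : measurableType d) (T : measurableType d') (R : realType).
Variables (r : {sigma_finite_measure set W -> \bar R})
  (m : {sigma_finite_measure set T -> \bar R}) (Y : W -> T) (U : W -> R).
Hypotheses (mY : measurable_fun setT Y) (rY : measure_eq (pushforward r Y) m).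
Hypotheses (mU : measurable_fun setT U) (U0 : forall w, (0 <= U w)%R).

Let mpre (E : set T) : measurable E -> measurable (Y @^-1` E).
Proof. by move=> mE; rewrite -[X in measurable X]setTI; exact: mY. Qed.

Let mUE : measurable_fun setT (EFin \o U). Proof. exact/measurable_EFinP. Qed.

(** As [U] is finite, the sets of finite [r]-measure may be cut down to where [U <= n]; there the
    mass is at most [n * r (F n)]. *)
Lemma sigma_finite_density (u : {measure set W -> \bar R}) :
  (forall E, measurable E -> u E = \int[r]_(w in E) (U w)%:E) ->
  sigma_finite setT u.
Proof.
move=> uE; have /sigma_finiteP := sigma_finiteT r; move=> [F [FT ndF mF]].
pose G n := F n `&` [set w | (U w <= n%:R)%R].
have mG n : measurable (G n).
  apply: measurableI; first by have [] := mF n.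
  by rewrite -[X in measurable X]setTI; exact: measurable_fun_le.
exists G.
  apply/esym; rewrite -subTset => w _; have : setT w by [].
  rewrite FT => -[i _ Fiw]; pose n := maxn i (Num.truncn (U w)).+1.
  exists n => //; split.
    by have /subsetPset := ndF i n (leq_maxl _ _); exact.
  by rewrite /= ltW// (lt_le_trans (truncnS_gt _))// ler_nat leq_maxr.
move=> n; split => //; rewrite uE//.
apply: (@le_lt_trans _ _ (n%:R%:E * r (F n))).
  rewrite -integral_cst; last by have [] := mF n.
  apply: (@le_trans _ _ (\int[r]_(w in G n) n%:R%:E)).
    apply: ge0_le_integral => //; [by move=> w _; rewrite lee_fin|exact: measurable_funTS|].
    by move=> w [_ /= ?]; rewrite lee_fin.
  by apply: ge0_subset_integral => //; [have [] := mF n|by move=> w []].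
by rewrite lte_mul_pinfty// ?lee_fin//; have [] := mF n.
Qed.

(** Without integrability of [U], the image of [U r] under [Y] may fail to be sigma-finite. The
    measure [U r] is therefore split into finite pieces [s n], the Radon-Nikodym theorem is applied
    to the image of each, and the densities are summed, possibly to [+oo]. *)
Lemma cond_exp_exists : exists e, is_cond_exp r Y U e.
Proof.
have [u uE'] := measure_of_density r mUE (fun w => U0 w).
have uE E : measurable E -> u E = \int[r]_(w in E) (U w)%:E by move=> _; rewrite -uE'.
have [s sfin sE] := sfinite_measure_sigma_finite (sigma_finite_density uE).
have ur : u `<< r := dominates_density mUE uE.
have s_le n E : measurable E -> s n E <= u E.
  move=> mE; rewrite sE// /mseries (nneseriesD1 (n := n))//=.
  by rewrite leeDl// nneseries_ge0.
have /choice[e eP] n : exists e : T -> \bar R, [/\ measurable_fun setT e,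
    (forall y, 0 <= e y) &
    forall E, measurable E -> s n (Y @^-1` E) = \int[m]_(y in E) e y].
  have [q qE] := image_measure (s n) mY.
  have qoo : q setT < +oo.
    rewrite -qE /pushforward preimage_setT ltey_eq.
    by rewrite (sfin n setT measurableT).
  have [q' q'E] := finite_measureP qoo.
  have q'm : q' `<< m.
    apply/null_content_dominatesP => E mE mE0.
    rewrite -q'E -qE /pushforward; apply/eqP; rewrite -measure_le0.
    rewrite (le_trans (s_le _ _ (mpre mE)))//.
    have /null_content_dominatesP -> // := ur; first exact: mpre.
    by transitivity (m E); [exact: rY|exact: mE0].
  have [e [e0 _ ie eE]] := radon_nikodym_sigma_finite q'm.
  exists e; split => //; first exact: measurable_int ie.
  by move=> E mE; rewrite -eE// -q'E -qE.
have me n : measurable_fun setT (e n) by have [] := eP n.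
have e0 n y : 0 <= e n y by have [] := eP n.
exists (fun y => \sum_(n <oo) e n y); split.
- by apply: ge0_emeasurable_sum.
- by move=> y; apply: nneseries_ge0.
move=> E mE; have [q qE] := image_measure r mY.
rewrite qE (eq_measure_integral m); last first.
  by move=> E' mE' _; rewrite -qE rY.
rewrite integral_nneseries//; last by move=> n; exact: measurable_funTS.
rewrite -uE ?sE; [|exact: mpre|exact: mpre].
by apply: eq_eseriesr => n _; have [_ _] := eP n; apply.
Qed.

(** Over every measurable [E] both sides have integral [mu E]; as [rn_deriv mu m] is integrable,
    they agree almost everywhere. *)
Lemma ae_cond_exp_density (f : T -> R) (mu : probability T R) :
  measurable_fun setT f -> (forall y, 0 <= f y)%R ->
  is_density mu m (rn_deriv mu m) ->
  (forall E, measurable E ->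
    mu E = \int[r]_(w in Y @^-1` E) (f (Y w) * U w)%:E) ->
  {ae m, forall y, (f y)%:E * cond_exp r Y U y = (rn_deriv mu m y)%:E}.
Proof.
move=> mf f0 [mrn rn0 rnE] muE.
have [me e0 eE] : is_cond_exp r Y U (cond_exp r Y U) := xgetPex _ cond_exp_exists.
set e := cond_exp r Y U in me e0 eE *.
have [u uE'] := measure_of_density r mUE (fun w => U0 w).
have uE E : measurable E -> u E = \int[r]_(w in E) (U w)%:E by move=> _; rewrite -uE'.
have [v vE] := image_measure u mY.
have {}vE : measure_eq (pushforward u Y) v by rewrite vE.
have vm E : measurable E -> v E = \int[m]_(y in E) e y.
  move=> mE; rewrite -vE// /pushforward uE; last exact: mpre.
  rewrite eE//; have [q qE] := image_measure r mY.
  rewrite qE; apply: eq_measure_integral => E' mE' _; by rewrite -qE rY.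
have mfE : measurable_fun setT (EFin \o f) by exact/measurable_EFinP.
have fE y : 0 <= (EFin \o f) y by rewrite lee_fin.
have mfe : measurable_fun setT (fun y => (f y)%:E * e y) by exact: emeasurable_funM.
have irn : m.-integrable setT (EFin \o rn_deriv mu m).
  apply/integrableP; split; first exact/measurable_EFinP.
  under eq_integral do rewrite gee0_abs ?lee_fin//.
  by have := rnE _ measurableT; rewrite /with_density => <-; rewrite probability_setT ltry.
suff h : ae_eq m setT (EFin \o rn_deriv mu m) (fun y => (f y)%:E * e y).
  by apply: filterS h => y /(_ I).
apply: integral_ae_eq => // E _ mE.
transitivity (mu E); first by rewrite rnE.
have mfE' : measurable_fun setT ((EFin \o f) \_ E).
  by apply/(measurable_restrictT _ mE); exact: measurable_funTS.
have f0E y : 0 <= ((EFin \o f) \_ E) y by rewrite patchE; case: ifP.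
transitivity (\int[v]_y ((EFin \o f) \_ E) y).
  rewrite -(ge0_integral_marginal mY vE)// (ge0_integral_density mUE (fun w => U0 w) uE)//.
    rewrite muE// [LHS]integral_mkcond; apply: eq_integral => w _.
    rewrite !patchE (_ : (w \in Y @^-1` E) = (Y w \in E))//.
    by case: ifP => // _; rewrite mul0e.
  exact: (measurableT_comp mfE' mY).
rewrite (ge0_integral_density me e0 vm)// [RHS]integral_mkcond.
by apply: eq_integral => y _; rewrite !patchE; case: ifP => // _; rewrite mul0e.
Qed.

End conditional_expectation.

(** * Path space and the Schrödinger theorem *)

Section path_measurability.
Context {R : realType} {X : ptopologicalType} {k : path_kind}.

Lemma measurable_coord (t : time R) :
  measurable_fun setT (Defs.coord t : pathspace R X k -> borel X).
Proof.
move=> _ B mB; rewrite setTI; apply: sub_sigma_algebra.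
by exists t, B.
Qed.

End path_measurability.

Lemma mixture_id (R : realType) (X : ptopologicalType) (t : R)
    (mu : probability (borel X) R) : (0 < t < 1)%R ->
  measure_eq mu (mixture t mu mu).
Proof.
move=> /andP[t0 t1] E mE; rewrite /mixture -ge0_muleDl ?lee_fin ?subr_ge0 ?ltW//.
by rewrite -EFinD subrK mul1e.
Qed.

Theorem theorem2p9 (R : realType)
  (* a Polish space, with a complete metric fixed *)
  (X : completePseudoMetricType R) (hausX : hausdorff_space X)
  (sepX : exists2 D : set X, countable D & dense D)
  (k : path_kind)
  (Rf : {sigma_finite_measure set (pathspace R X k) -> \bar R})
  (Rf_neq0 : Rf setT != 0)
  (m : {measure set (borel X) -> \bar R})
  (A B : borel X -> R)
  (mA : measurable_fun setT A) (A_ge0 : forall x, (0 <= A x)%R)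
  (mB : measurable_fun setT B) (B_ge0 : forall x, (0 <= B x)%R)
  (h_i : measure_eq (law0 Rf) m /\ measure_eq (law1 Rf) m)
  (h_ii : forall E : set (borel X * borel X), measurable E ->
    with_density (fun z => expR (- A z.1 - A z.2)) (m \x m) E <= law01 Rf E)
  (h_iii : \int[law01 Rf]_z (expR (- B z.1 - B z.2))%:E < +oo)
  (h_iv : (m \x m) `<< law01 Rf \/ law01 Rf `<< (m \x m))
  (mu0 mu1 : probability (borel X) R)
  (h_v : entropy mu0 m < +oo /\ entropy mu1 m < +oo)
  (h_vi : \int[mu0]_x (A x + B x)%:E < +oo /\
          \int[mu1]_x (A x + B x)%:E < +oo) :
  (m setT = 1 ->
   (exists2 eps : R, (0 < eps)%R & forall E, measurable E ->
      eps%:E * m E <= mu0 E /\ eps%:E * m E <= mu1 E) ->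
   internal (law01 Rf) mu0 mu1)
  /\
  (internal (law01 Rf) mu0 mu1 ->
   exists (f0 g1 : borel X -> R)
          (Phat : probability (pathspace R X k) R)
          (pihat : probability (borel X * borel X)%type R),
   [/\ [/\ measurable_fun setT f0, measurable_fun setT g1,
           (forall x, 0 <= f0 x)%R & (forall y, 0 <= g1 y)%R],
       unique_solution Rf (path_couplings mu0 mu1) Phat
         /\ measure_eq Phat (with_density (fun w => f0 (X0 w) * g1 (X1 w))%R Rf),
       unique_solution (law01 Rf) (couplings mu0 mu1) pihat
         /\ measure_eq pihat
              (with_density (fun z => f0 z.1 * g1 z.2)%R (law01 Rf)),
       {ae m, forall x,
          (f0 x)%:E * cond_exp Rf X0 (fun w => g1 (X1 w)) x
            = (rn_deriv mu0 m x)%:E}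
     & {ae m, forall y,
          (g1 y)%:E * cond_exp Rf X1 (fun w => f0 (X0 w)) y
            = (rn_deriv mu1 m y)%:E}]).
Proof.
have mX0 : measurable_fun setT (@X0 R X k) by exact: measurable_coord.
have mX1 : measurable_fun setT (@X1 R X k) by exact: measurable_coord.
have [M0 M0E] := image_measure Rf (measurable_fun_pair mX0 mX1).
have {}M0E : law01 Rf = M0 by [].
rewrite M0E in h_ii h_iii h_iv *.
have mw : measurable_fun setT (fun z : (borel X * borel X)%type => expR (- B z.1 - B z.2)).
  apply: measurableT_comp => //.
  by apply: measurable_funB; [apply: measurableT_comp => //|]; exact: measurableT_comp.
(* By (iii) a positive function is integrable for the endpoint law, which is therefore
   sigma-finite. *)
have [M ME] := sigma_finite_measureP
  (sigma_finite_integrable mw (fun z => expR_gt0 _) h_iii).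
rewrite {}ME {h_iv} in M0E h_ii h_iii *.
(* As an image of [Rf], the measure [m] is s-finite; (ii) and (iii) improve this to sigma-finite. *)
have sm : sfinite_measure m by exact: sfinite_image mX0 h_i.1.
have [m' m'E] := sigma_finite_measureP (sigma_finite_of_product sm mA mB h_ii h_iii).
rewrite {}m'E in h_i h_ii h_v *.
have [f [g [a [b [L [[mf mg f0 g0] [ia ib] [iexp mass abM cL] [marg0 marg1]
  [p [pE ilnp lnpL]]]]]]]] := static_potentials mA A_ge0 mB B_ge0 h_ii h_iii
    h_v.1 h_v.2 h_vi.1 h_vi.2.
have RfM : measure_eq (pushforward Rf (fun w => (X0 w, X1 w))) M.
  by move=> E mE; rewrite -M0E.
(* [M] is its own image under the pair of projections, which makes the static problem an instance of
   [endpoint_solution]. *)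
have MM : measure_eq (pushforward M (fun z => (z.1, z.2))) M.
  by move=> E mE; rewrite /pushforward; congr (M _); apply/seteqP; split => [[]|[]].
(* The same [f] and [g] give both solutions. *)
have [Phat [uPhat PhatE]] := endpoint_solution mX0 mX1 RfM mf mg f0 g0 ia ib
  iexp mass abM cL marg0 marg1 pE ilnp lnpL.
have [pihat [upihat pihatE]] := endpoint_solution measurable_fst measurable_snd MM
  mf mg f0 g0 ia ib iexp mass abM cL marg0 marg1 pE ilnp lnpL.
split=> [_ _|_].
  (* The pair is admissible because [pihat] is a coupling of finite entropy, and it lies in the
     segment from itself to itself, taken at the midpoint. *)
  have [[cpihat fpihat _] _] := upihat.
  have adm : admissible M (mu0, mu1).
    apply: le_lt_trans (_ : entropy pihat M < +oo); last by rewrite ltey_eq fpihat.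
    by apply: ereal_inf_lbound; exists pihat.
  have half : (0 < (2^-1 : R) < 1)%R by apply/andP; split; lra.
  split => //; exists (mu0, mu1), (mu0, mu1); split => //.
  by exists 2^-1%R; split => //; exact: mixture_id.
have [den0 _ _] := entropy_lty h_v.1; have [den1 _ _] := entropy_lty h_v.2.
(* Rewrites the marginal identities for [M] as integrals over paths, the form in which
   [ae_cond_exp_density] takes them. *)
have endE := integral_endpoint_density mX0 mX1 RfM mf mg f0 g0.
exists f, g, Phat, pihat; split => //.
- apply: (ae_cond_exp_density mX0 h_i.1) => //; first exact: measurableT_comp.
  move=> E mE; rewrite -marg0// -endE//.
  by rewrite -[X in measurable X]setTI; exact: measurable_fst.
- apply: (ae_cond_exp_density mX1 h_i.2) => //; first exact: measurableT_comp.
  move=> E mE; under eq_integral do rewrite mulrC.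
  rewrite -marg1// -endE//.
  by rewrite -[X in measurable X]setTI; exact: measurable_snd.
Qed.
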